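(* Let $1\le m\le n$ be integers and let $I$ and $J$ be ordered $m$-element subsets (i.e. $m$-tuples of distinct elements) of $[m+n]=\{1,\dots,m+n\}$. Let $\eta=|I\setminus J|=|J\setminus I|$, and fix a labeling $I\setminus J=\{i_1,\dots,i_\eta\}$, $J\setminus I=\{j_1,\dots,j_\eta\}$ as described in the context. For $k,r\in[1,\eta]$ let $I_{k,r}$ be the tuple obtained from $I$ by replacing the entry $i_r$ by $j_k$ (in the same position), and $J_{k,r}$ the tuple obtained from $J$ by replacing the entry $j_k$ by $i_r$ (in the same position). Consider the following system of inequalities, for $l,r\in[1,\eta]$, over $\mathrm{Gr}^{\ge 0}(m,m+n)$: \[ \mathrm{sgn}(I_{l,r})\,\mathrm{sgn}(J_{l,r})\sum_{k=1}^{l}\Delta_{I_{k,r}}\Delta_{J_{k,r}}\ \ge 0 \quad\text{for } l<\eta-r+1, \] \[ \mathrm{sgn}(I_{l,r})\,\mathrm{sgn}(J_{l,r})\Big(\sum_{k=1}^{l}\Delta_{I_{k,r}}\Delta_{J_{k,r}}-\Delta_I\Delta_J\Big)\ \ge 0 \quad\text{for } l\ge \eta-r+1. \] This system holds for all $l,r\in[1,\eta]$ if and only if $I$ and $J$ are weakly separated.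
   Context: Grassmannian and Plücker coordinates: $\mathrm{Gr}(m,m+n)$ is the set of $m$-dimensional subspaces of $\mathbb{R}^{m+n}$, each represented by a full-rank matrix $X\in\mathbb{R}^{(m+n)\times m}$ (whose column span is the subspace). For an ordered tuple $I=(i_1,\dots,i_m)$ of elements of $[m+n]$, $\Delta_I(X)$ is the determinant of the $m\times m$ matrix whose $t$-th row is row $i_t$ of $X$; thus $\Delta_{(i_{w(1)},\dots,i_{w(m)})}=(-1)^{\mathrm{sgn}(w)}\Delta_{(i_1,\dots,i_m)}$ for permutations $w$, and for a set $I$ one uses the increasing order. For an ordered tuple $I=(i_1,\dots,i_m)$ of distinct elements, $\mathrm{sgn}(I)=(-1)^{\mathrm{sgn}(w)}$ (the sign of the permutation $w\in S_m$ with $i_{w(1)}<\dots<i_{w(m)}$). The totally nonnegative Grassmannian $\mathrm{Gr}^{\ge0}(m,m+n)$ consists of the subspaces having a representative matrix all of whose maximal minors $\Delta_I$ are $\ge 0$. A quadratic expression $\sum c_{I,J}\Delta_I\Delta_J$ is said to be $\ge 0$ over $\mathrm{Gr}^{\ge0}(m,m+n)$ if $\sum c_{I,J}\Delta_I(X)\Delta_J(X)\ge0$ for every $V\in\mathrm{Gr}^{\ge0}(m,m+n)$ and every representative matrix $X$ of $V$. Place the points $1,2,\dots,m+n$ on a circle in clockwise order. $I$ and $J$ are weakly separated if the sets $I\setminus J$ and $J\setminus I$ can be separated by a chord of the circle. Labeling: the elements of $I\setminus J$ and $J\setminus I$ are labeled $i_1,\dots,i_\eta$ and $j_1,\dots,j_\eta$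 so that, in the clockwise order $<_c$ obtained by moving clockwise around the circle starting from $i_1$, one has $i_1<_c i_2<_c\dots<_c i_\eta<_c j_\eta$ and $i_1<_c j_1<_c\dots<_c j_\eta$; that is, $i_1\in I\setminus J$ and $j_\eta\in J\setminus I$ are chosen so that all other elements of $(I\setminus J)\cup(J\setminus I)$ lie strictly between $i_1$ and $j_\eta$ when traversing clockwise from $i_1$. (Example: $m=n=6$, $I=(1,5,3,4,10,11)$, $J=(2,6,7,8,9,11)$ gives $(i_1,\dots,i_5)=(10,1,3,4,5)$, $(j_1,\dots,j_5)=(2,6,7,8,9)$.) *)

(* Defs.v *)
From HB Require Import structures.
From mathcomp Require Import all_boot all_order all_algebra all_fingroup.
From mathcomp Require Import reals.

Set Implicit Arguments.
Unset Strict Implicit.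
Unset Printing Implicit Defensive.

Import Order.TTheory GRing.Theory Num.Theory.
Local Open Scope ring_scope.

(* The points 1, ..., N of the circle are the ordinals 0, ..., N - 1. *)

Section Circle.
Variable N : nat.
Implicit Types (a p q x y : 'I_N) (A B : {set 'I_N}).

(* Number of clockwise unit steps from a to x. *)
Definition cw_dist a x : nat := ((x + (N - a)) %% N)%N.

Definition cw_lt a : rel 'I_N := fun x y => (cw_dist a x < cw_dist a y)%N.

(* A chord is given by the gaps containing its endpoints: just before p and
   just before q. It cuts the circle into two arcs; the marked points on the arc
   clockwise from the first endpoint to the second are p, p + 1, ..., q - 1. *)
Definition chord_side p q : {set 'I_N} :=
  [set x | (cw_dist p x < cw_dist p q)%N].

Definition separated_by_chord A B : Prop :=
  exists p q,
    (A \subset chord_side p q) && (B \subset ~: chord_side p q) ||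
    (B \subset chord_side p q) && (A \subset ~: chord_side p q).

End Circle.

Section Tuples.
Variables m N : nat.
Implicit Types (I J : m.-tuple 'I_N) (x y : 'I_N).

Definition weakly_separated I J : Prop :=
  separated_by_chord ([set x in I] :\: [set x in J])
                     ([set x in J] :\: [set x in I]).

(* The sequences i and j have length eta, so for eta > 0 the term last i1 j is
   j_eta. For eta = 0 there is nothing to label. *)
Definition labeling I J (eta : nat) (i j : eta.-tuple 'I_N) : Prop :=
  [/\ [set x in i] = [set x in I] :\: [set x in J],
      [set x in j] = [set x in J] :\: [set x in I] &
      if tval i is i1 :: _ then
        sorted (cw_lt i1) (rcons i (last i1 j)) && sorted (cw_lt i1) (i1 :: j)
      else true].

Definition replace_entry I x y : m.-tuple 'I_N :=
  [tuple if tnth I t == x then y else tnth I t | t < m].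

Definition sorting_perm I (w : 'S_m) : bool :=
  [forall s : 'I_m, forall t : 'I_m, (s < t)%N ==> (tnth I (w s) < tnth I (w t))%N].

(* For distinct entries there is exactly one sorting permutation; the value 0
   is only taken on tuples with a repeated entry. *)
Definition tuple_sgn (R : pzRingType) I : R :=
  if [pick w | sorting_perm I w] is Some w then (-1) ^+ w else 0.

Definition plucker (R : comPzRingType) I (X : 'M[R]_(N, m)) : R :=
  \det (rowsub (tnth I) X).

End Tuples.

Section Grassmannian.
Variables (R : realType) (m n : nat).
Implicit Types (V : {vspace 'cV[R]_(m + n)}) (X : 'M[R]_(m + n, m)).

Definition in_Gr V : Prop := \dim V = m.

Definition represents X V : Prop :=
  \rank X = m /\ <<[seq col t X | t : 'I_m]>>%VS = V.

Definition in_tnn_Gr V : Prop :=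
  in_Gr V /\
  exists2 X, represents X V &
    forall K : m.-tuple 'I_(m + n),
      sorted (fun a b : 'I_(m + n) => a < b)%N K -> 0 <= plucker K X.

Definition ge0_over_tnn_Gr (Q : 'M[R]_(m + n, m) -> R) : Prop :=
  forall V, in_tnn_Gr V -> forall X, represents X V -> 0 <= Q X.

End Grassmannian.

(* Main.v *)
(* Write p(K) for the maximal minor of X on the rows K, and read the circle
   clockwise from i_1. If I and J are weakly separated, then I \ J comes before
   J \ I. For x in I \ J let S be the sum of p(I[x -> y]) p(J[y -> x]) over a
   final segment of J \ I having at most as many elements as there are elements
   of I \ J before x; the claim is that S has the sign of its first term. Let z
   be the first element of I \ J, y' the last one of J \ I, and J' = J[y' -> z].
   The three-term and the long Pluecker relations give
     p(J') S = p(J) S' - p(J[y' -> x]) H,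
   where S' is the sum analogous to S for the pair (I, J'), and H is, up to sign,
   such a sum for the pair (I[x -> y'], J') when the circle is read
   counterclockwise from another starting point. When all minors are positive
   this proves the claim by induction on the size of J \ I; the totally
   nonnegative case follows by perturbation. Initial segments reduce to final
   ones by reading the circle backwards.
   Conversely, if I and J are not weakly separated, take i_r and j_q consecutive
   in (I \ J) U (J \ I), and a Vandermonde matrix in which the nodes of i_r and
   j_q nearly collide. Then p(I_{k,r}) p(J_{k,r}) / (p(I) p(J)) is close to 1 for
   k = q and to 0 otherwise, and its sign is the parity of the number of elements
   of (I \ J) U (J \ I) between i_r and j_k; a parity count yields r, q and l for
   which the inequality fails. *)

Require Import Defs.
From HB Require Import structures.
From mathcomp Require Import all_boot all_order all_algebra all_fingroup.
From mathcomp Require Import reals.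
From mathcomp Require Import boolp ring lra zify.

Set Implicit Arguments.
Unset Strict Implicit.
Unset Printing Implicit Defensive.

Import Order.TTheory GRing.Theory Num.Theory.
Local Open Scope ring_scope.

(** * Maximal minors and Pluecker relations *)

Definition upd (A : eqType) (B : Type) (K : A -> B) s y : A -> B :=
  fun t => if t == s then y else K t.

Section Upd.
Variables (A B : eqType).
Implicit Types (K : A -> B) (s t : A) (x y : B).

Lemma upd_eq K s y : upd K s y s = y.
Proof. by rewrite /upd eqxx. Qed.

Lemma upd_neq K s y t : t != s -> upd K s y t = K t.
Proof. by rewrite /upd => /negPf ->. Qed.

Lemma upd_id K s : upd K s (K s) = K.
Proof. by apply: funext => t; rewrite /upd; case: eqP => // ->. Qed.

Lemma upd_upd K s x y : upd (upd K s x) s y = upd K s y.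
Proof. by apply: funext => t; rewrite /upd; case: eqP. Qed.

Lemma updC K s t x y : s != t ->
  upd (upd K s x) t y = upd (upd K t y) s x.
Proof.
move=> st; apply: funext => u; rewrite /upd.
by have [->|//] := eqVneq u t; rewrite eq_sym (negPf st).
Qed.

Lemma upd_inj K s y : injective K -> (forall t, t != s -> K t != y) ->
  injective (upd K s y).
Proof.
move=> iK ny t u; rewrite /upd.
have [->|ts] := eqVneq t s; have [->|us] := eqVneq u s => //.
- by move=> e; move: (ny _ us); rewrite e eqxx.
- by move=> e; move: (ny _ ts); rewrite e eqxx.
- exact: iK.
Qed.

End Upd.

Section Minor.
Variables (R : comNzRingType) (N m : nat).
Implicit Types (X : 'M[R]_(N, m)) (K I J : 'I_m -> 'I_N) (s t : 'I_m).

Definition minor X K : R := \det (rowsub K X).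

(** The cofactors along row [s] do not involve that row, so the minor is a linear form in the row
    placed there, with coefficients from the adjugate. *)
Lemma minor_upd X K s y :
  minor X (upd K s y) = (row y X *m \adj (rowsub K X)) 0 s.
Proof.
rewrite /minor (expand_det_row _ s) !mxE; apply: eq_bigr => j _.
rewrite !mxE upd_eq; congr (_ * _); rewrite /cofactor; congr (_ * \det _).
by apply/matrixP => a b; rewrite !mxE upd_neq // eq_sym neq_lift.
Qed.

Lemma minor_comp_perm X K (w : 'S_m) :
  minor X (K \o w) = (-1) ^+ w * minor X K.
Proof.
rewrite /minor -det_perm -det_mulmx -row_permE.
by congr (\det _); apply/matrixP => a b; rewrite !mxE.
Qed.

Lemma minor_alt X K s t : s != t -> K s = K t -> minor X K = 0.
Proof.
move=> st e; apply: (determinant_alternate st) => j.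
by rewrite !mxE e.
Qed.

Lemma minor_swap X K s t x y : s != t ->
  minor X (upd (upd K s x) t y) = - minor X (upd (upd K s y) t x).
Proof.
move=> st; rewrite -[RHS]mulN1r.
rewrite -[-1 in RHS](_ : (-1) ^+ (tperm s t : 'S_m) = -1 :> R); last first.
  by rewrite odd_tperm st expr1.
rewrite -minor_comp_perm; congr minor; apply: funext => u /=.
rewrite /upd; case: tpermP => [->|->|/eqP/negPf us /eqP/negPf ut].
- by rewrite !eqxx (negPf st).
- by rewrite !eqxx (negPf st).
- by rewrite us ut.
Qed.

(* Both sides are linear in row [I s]; the left one expands it by Cramer's rule
   in the rows of [J]. *)
Lemma minor_exchange X I J s :
  \sum_t minor X (upd I s (J t)) * minor X (upd J t (I s)) =
  minor X I * minor X J.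
Proof.
pose A := rowsub I X; pose B := rowsub J X.
have -> : minor X I = (row (I s) X *m \adj A) 0 s by rewrite -minor_upd upd_id.
transitivity ((row (I s) X *m \adj B *m B *m \adj A) 0 s); last first.
  rewrite -[_ *m _ *m B]mulmxA mul_adj_mx mul_mx_scalar -scalemxAl mxE mulrC.
  by [].
rewrite -[_ *m \adj B *m B *m _]mulmxA mxE; apply: eq_bigr => t _.
rewrite !minor_upd mulrC; congr (_ * _).
by rewrite !mxE; apply: eq_bigr => u _; rewrite !mxE.
Qed.

(** The exchange relation between [upd (upd J t1 z) t0 x] and [J] has only two surviving terms: for
    [t] other than [t0] and [t1] the row [J t] occurs twice. *)
Lemma minor_three_term X J t0 t1 x z : t0 != t1 ->
  minor X (upd J t1 z) * minor X (upd J t0 x) =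
  minor X J * minor X (upd (upd J t1 z) t0 x)
  + minor X (upd J t1 x) * minor X (upd J t0 z).
Proof.
move=> t01; have t10 : t1 != t0 by rewrite eq_sym.
have := minor_exchange X (upd (upd J t1 z) t0 x) J t0.
rewrite upd_eq (bigD1 t0) // (bigD1 t1) //= big1 => [|t /andP[tt0 tt1]]; last first.
  rewrite upd_upd (@minor_alt _ _ t t0) ?mul0r // upd_eq upd_neq //.
  by rewrite upd_neq.
rewrite !upd_upd addr0.
have -> : upd (upd J t1 z) t0 (J t0) = upd J t1 z.
  by rewrite -[in RHS](upd_id J t0) updC.
by rewrite (minor_swap _ _ z (J t1) t10) upd_id => e; rewrite [minor X J * _]mulrC -e; ring.
Qed.

Lemma minor_mulmx X K (g : 'M[R]_m) : minor (X *m g) K = minor X K * \det g.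
Proof.
by rewrite /minor -det_mulmx; congr (\det _); apply/matrixP => a b; rewrite !mxE;
   apply: eq_bigr => u _; rewrite !mxE.
Qed.

End Minor.

(** * Signs of minors and cyclic orders *)

Section Range.
Variables (N m : nat).
Implicit Types (K I J : 'I_m -> 'I_N) (s t : 'I_m).

Definition range K : {set 'I_N} := [set K u | u : 'I_m].

Lemma mem_range K s : K s \in range K.
Proof. exact: imset_f. Qed.

Lemma rangeP K e : reflect (exists s, e = K s) (e \in range K).
Proof. by apply: (iffP imsetP) => -[s]; [move=> _ ->; exists s | move=> ->; exists s]. Qed.

Lemma notin_range K e s : e \notin range K -> K s != e.
Proof. by apply: contraNneq => <-; exact: mem_range. Qed.

Lemma upd_inj_range K s y : injective K -> y \notin range K ->
  injective (upd K s y).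
Proof. by move=> iK yK; apply: upd_inj => // t _; exact: notin_range. Qed.

Lemma card_range K : injective K -> #|range K| = m.
Proof. by move=> iK; rewrite card_imset // card_ord. Qed.

Lemma range_upd K s y : injective K -> y \notin range K ->
  range (upd K s y) = y |: range K :\ K s.
Proof.
move=> iK yK; apply/setP => e; rewrite !inE; apply/rangeP/idP.
  move=> [t ->]; rewrite /upd; have [_|ts] := eqVneq t s; first by rewrite eqxx.
  by rewrite mem_range andbT (inj_eq iK) ts orbT.
case/predU1P => [->|/andP[es /rangeP[t et]]]; first by exists s; rewrite upd_eq.
by exists t; rewrite upd_neq // -(inj_eq iK) -et.
Qed.

Lemma card_rangeD I J : injective I -> injective J ->
  #|range I :\: range J| = #|range J :\: range I|.
Proof.
move=> iI iJ; have := cardsID (range J) (range I).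
have := cardsID (range I) (range J).
by rewrite !card_range // setIC; lia.
Qed.

End Range.

Section Sign.
Variables (R : realFieldType).
Implicit Types a b c : R.

(** Signs are compared through products: [0 < a * b] says that [a] and [b] have the same sign, so
    one may stand in for the other. *)
Lemma same_sign_ge0 a b c : 0 < a * b -> 0 <= b * c -> 0 <= a * c.
Proof.
move=> ab bc; have b0 : b != 0 by apply: contraTneq ab => ->; rewrite mulr0 ltxx.
have : 0 <= (a * b) * (b * c) by rewrite mulr_ge0 // ltW.
have -> : a * b * (b * c) = b ^+ 2 * (a * c) by ring.
by rewrite pmulr_rge0 // exprn_even_gt0.
Qed.

Lemma same_sign_trans a b c : 0 < a * b -> 0 < b * c -> 0 < a * c.
Proof.
move=> ab bc; have b0 : b != 0 by apply: contraTneq ab => ->; rewrite mulr0 ltxx.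
have : 0 < (a * b) * (b * c) by rewrite mulr_gt0.
have -> : a * b * (b * c) = b ^+ 2 * (a * c) by ring.
by rewrite pmulr_rgt0 // exprn_even_gt0.
Qed.

Lemma prod_sign_sq (T : finType) (P : pred T) (f : T -> R) :
  (forall u, f u * f u = 1) -> (\prod_(u | P u) f u) * (\prod_(u | P u) f u) = 1.
Proof. by move=> f2; rewrite -big_split big1 //= => u _; apply: f2. Qed.

End Sign.

Section Oriented.
Variables (R : realFieldType) (N m : nat) (X : 'M[R]_(N, m)).
Implicit Types (K I J : 'I_m -> 'I_N) (s t : 'I_m) (rho : 'I_N -> nat).
Implicit Types (theta : 'I_N -> R) (e x y z : 'I_N).

Local Notation p := (minor X).

Definition side rho e y : R := if (rho e < rho y)%N then 1 else -1.

(** Equals -1 exactly when [e] lies between [y] and [y'], the earlier of the two included: the sign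
    picked up when a row moving from [y] to [y'] passes [e]. *)
Definition side2 rho y y' e : R := side rho e y * side rho e y'.

Lemma side_sq rho e y : side rho e y * side rho e y = 1.
Proof. by rewrite /side; case: ifP; rewrite ?mulrNN mulr1. Qed.

Lemma side2_sq rho y y' e : side2 rho y y' e * side2 rho y y' e = 1.
Proof. by rewrite /side2 mulrACA !side_sq mulr1. Qed.

(* The factor [theta] absorbs the signs that minors acquire when the circle is
   rotated or reflected, so that this holds for all its cyclic readings [rho]. *)
Definition oriented rho theta := forall K s y y',
  injective (upd K s y) -> injective (upd K s y') ->
  0 < p (upd K s y) * p (upd K s y') * (theta y * theta y')
      * \prod_(u | u != s) side2 rho y y' (K u).

Lemma oriented_neq0 rho theta K s : oriented rho theta -> injective K ->
  p K != 0.
Proof.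
move=> o iK; have := o K s (K s) (K s); rewrite upd_id => /(_ iK iK).
by apply: contraTneq => ->; rewrite !mul0r ltxx.
Qed.

(** The [theta] factors depend only on [y] and [y'], so they form a square when the same replacement
    is made in two tuples. *)
Lemma oriented_pair rho theta K s L t y y' : oriented rho theta ->
  injective (upd K s y) -> injective (upd K s y') ->
  injective (upd L t y) -> injective (upd L t y') ->
  0 < (p (upd K s y) * p (upd K s y')) * (p (upd L t y) * p (upd L t y'))
      * ((\prod_(u | u != s) side2 rho y y' (K u))
         * (\prod_(u | u != t) side2 rho y y' (L u))).
Proof.
move=> o K1 K2 L1 L2; have k := o K s y y' K1 K2; have l := o L t y y' L1 L2.
have th : theta y * theta y' != 0.
  by apply: contraTneq k => ->; rewrite mulr0 mul0r ltxx.
have := mulr_gt0 k l; set a := \prod_(u | _) _; set b := \prod_(u | _) _.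
set A := p _ * _; set B := p _ * _; set T := _ * theta _.
have -> : A * T * a * (B * T * b) = T ^+ 2 * (A * B * (a * b)) by ring.
by rewrite pmulr_rgt0 // exprn_even_gt0.
Qed.

(** Of the two tuples in which [J t0] is traded for [x], one contains [J t1] and the other [z];
    neither row lies between [x] and [J t0], and every other row contributes its sign twice. *)
Lemma oriented_crossing rho theta J t0 t1 x z : oriented rho theta ->
  injective J -> x \notin range J -> z \notin range J -> t0 != t1 ->
  (rho z < rho x)%N -> (rho x < rho (J t0))%N -> (rho (J t0) < rho (J t1))%N ->
  0 < (p (upd J t1 z) * p (upd J t0 x)) * (p J * p (upd (upd J t1 z) t0 x)).
Proof.
move=> o iJ xJ zJ t01 zx x0 l01.
have t10 : t1 != t0 by rewrite eq_sym.
pose J' := upd J t1 z.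
have iJ' : injective J' by exact: upd_inj_range.
have xJ' : x \notin range J'.
  rewrite range_upd // !inE negb_or (negPf xJ) andbF andbT.
  by apply: contraTneq zx => ->; rewrite ltnn.
have e0 : J' t0 = J t0 by rewrite /J' upd_neq.
have := @oriented_pair rho theta J t0 J' t0 (J t0) x o.
rewrite upd_id -{1 2}e0 upd_id => /(_ iJ (upd_inj_range iJ xJ) iJ'
  (upd_inj_range iJ' xJ')).
pose f := side2 rho (J t0) x.
have -> : \prod_(u | u != t0) f (J u) * \prod_(u | u != t0) f (J' u)
    = f (J t1) * f z.
  rewrite (bigD1 t1) //= [in X in _ * X](bigD1 t1) //= mulrACA.
  rewrite [X in _ * (_ * X)](eq_bigr (fun u => f (J u))).
    by rewrite prod_sign_sq /J' ?upd_eq ?mulr1 // => u; exact: side2_sq.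
  by move=> u /andP[_ u1]; rewrite /J' upd_neq.
rewrite /f /side2 /side.
have -> : (rho (J t1) < rho (J t0))%N = false by lia.
have -> : (rho (J t1) < rho x)%N = false by lia.
have -> : (rho z < rho (J t0))%N by lia.
rewrite zx !mulr1 mulrNN !mulr1 -/J' => h.
by rewrite [X in 0 < X](_ : _ = p J * p (upd J t0 x) * (p J' * p (upd J' t0 x)));
   [exact: h | ring].
Qed.

(** The same cancellation when [z] is traded for [x] at positions [t1] and [t0]: the remaining rows
    [J t0] and [J t1] lie beyond both. Hence all three products in [minor_three_term] have one
    sign. *)
Lemma oriented_noncrossing rho theta J t0 t1 x z : oriented rho theta ->
  injective J -> x \notin range J -> z \notin range J -> t0 != t1 ->
  (rho z < rho x)%N -> (rho x < rho (J t0))%N -> (rho (J t0) < rho (J t1))%N ->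
  0 < (p (upd J t1 z) * p (upd J t0 x)) * (p (upd J t1 x) * p (upd J t0 z)).
Proof.
move=> o iJ xJ zJ t01 zx x0 l01.
have t10 : t1 != t0 by rewrite eq_sym.
have := @oriented_pair rho theta J t1 J t0 z x o
  (upd_inj_range iJ zJ) (upd_inj_range iJ xJ)
  (upd_inj_range iJ zJ) (upd_inj_range iJ xJ).
pose f := side2 rho z x.
have -> : \prod_(u | u != t1) f (J u) * \prod_(u | u != t0) f (J u)
    = f (J t0) * f (J t1).
  rewrite (bigD1 t0) //= [in X in _ * X](bigD1 t1) //= mulrACA.
  rewrite [X in _ * (_ * X)](eq_bigl (fun u => (u != t1) && (u != t0))).
    by rewrite prod_sign_sq ?mulr1 // => u; exact: side2_sq.
  by move=> u; rewrite andbC.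
rewrite /f /side2 /side.
have -> : (rho (J t0) < rho z)%N = false by lia.
have -> : (rho (J t0) < rho x)%N = false by lia.
have -> : (rho (J t1) < rho z)%N = false by lia.
have -> : (rho (J t1) < rho x)%N = false by lia.
rewrite !mulrNN !mulr1 => h.
by rewrite [X in 0 < X](_ : _ = p (upd J t1 z) * p (upd J t1 x) *
  (p (upd J t0 z) * p (upd J t0 x))); [exact: h | ring].
Qed.

(** Rows strictly between [J t] and [J t'] lie in both tuples or in neither, so their signs cancel.
    What remains is the transposition turning [upd (upd J t z) t' (J t)] into [upd J t' z]. Thus
    consecutive terms of a partial sum alternate in sign. *)
Lemma oriented_alternates rho theta I J s t t' z : oriented rho theta ->
  injective rho -> injective I -> injective J ->
  J t \notin range I -> J t' \notin range I -> z \notin range J ->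
  (rho (I s) < rho (J t))%N -> (rho z < rho (J t))%N ->
  (rho (J t) < rho (J t'))%N ->
  (forall e, (rho (J t) < rho e < rho (J t'))%N -> (e \in range I) = (e \in range J)) ->
  (p (upd I s (J t)) * p (upd J t z)) * (p (upd I s (J t')) * p (upd J t' z)) < 0.
Proof.
move=> o irho iI iJ tI t'I zJ st zt tt' agree.
have t_t' : t != t' by apply: contraTneq tt' => ->; rewrite ltnn.
pose L := upd J t z; have iL : injective L by exact: upd_inj_range.
have tL : J t \notin range L.
  by rewrite range_upd // !inE eqxx orbF; apply: contraTneq zt => ->; rewrite ltnn.
have eL : upd L t' (J t') = L by rewrite -[J t'](@upd_neq _ _ J t z) ?upd_id // eq_sym.
have := @oriented_pair rho theta I s L t' (J t) (J t') o
  (upd_inj_range iI tI) (upd_inj_range iI t'I) (upd_inj_range iL tL).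
rewrite eL => /(_ iL).
have -> : p (upd L t' (J t)) = - p (upd J t' z).
  by rewrite minor_swap // upd_id.
pose f := side2 rho (J t) (J t').
have fE e : f e = if (rho (J t) <= rho e < rho (J t'))%N then -1 else 1.
  rewrite /f /side2 /side; case: (ltnP (rho e) (rho (J t))) => h /=.
    by rewrite (ltn_trans h tt') mulr1.
  by case: ifP => _; rewrite ?mulr1 // mulrNN mulr1.
have prodI : \prod_(u | u != s) f (I u) = \prod_(e in range I) f e.
  rewrite big_imset /=; last by move=> ? ? _ _; exact: iI.
  rewrite [RHS](bigD1 s) //= fE ifF ?mul1r //; lia.
have prodJ : \prod_(u | u != t') f (L u) = - \prod_(e in range J) f e.
  rewrite big_imset /=; last by move=> ? ? _ _; exact: iJ.
  rewrite [in RHS](bigD1 t') //= [LHS](bigD1 t) //= [in RHS](bigD1 t) //=.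
  rewrite /L upd_eq !fE ifF ?mul1r; last by lia.
  rewrite [in RHS]ifF ?mul1r; last by lia.
  rewrite ifT; last by lia.
  rewrite mulN1r opprK; apply: eq_bigr => u /andP[_ ut].
  by rewrite upd_neq // fE.
have prodIJ : \prod_(e in range J) f e = - \prod_(e in range I) f e.
  rewrite (bigD1 (J t)) ?mem_range //= fE leqnn tt' mulN1r; congr (- _).
  rewrite big_mkcond [RHS]big_mkcond; apply: eq_bigr => e _ /=.
  rewrite fE; have [->|et] := eqVneq e (J t); first by rewrite (negPf tI) andbF.
  rewrite andbT; case: (boolP (_ <= _ < _)%N) => [h|_]; last by rewrite !if_same.
  rewrite agree //; have : rho e != rho (J t) by rewrite (inj_eq irho).
  by lia.
rewrite -[\prod_(u | u != s) _]/(\prod_(u | u != s) f (I u)).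
rewrite -[\prod_(u | u != t') _]/(\prod_(u | u != t') f (L u)).
rewrite prodI prodJ prodIJ opprK prod_sign_sq; last by move=> u; exact: side2_sq.
rewrite mulr1 -oppr_gt0 => h.
by rewrite [X in 0 < X](_ : _ = p (upd I s (J t)) * p (upd I s (J t')) *
   (- p (upd J t' z) * p L)); [exact: h | rewrite /L; ring].
Qed.

(** Here [kappa] accounts for a reversal of the circle and [vt] for a new cut. Each of the [m.-1]
    other rows contributes [vt y * vt y'], its remaining signs being squared; the new [theta]
    absorbs this. *)
Lemma oriented_change rho rho' theta (kappa : R) (vt : 'I_N -> R) :
  oriented rho theta -> kappa ^+ 2 = 1 -> (forall e, vt e ^+ 2 = 1) ->
  (forall e y, e != y -> side rho' e y = kappa * (vt e * vt y) * side rho e y) ->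
  oriented rho' (fun e => theta e * vt e ^+ m.-1).
Proof.
move=> o k2 v2 sE K s y y' iy iy'; have := o K s y y' iy iy'.
have -> : \prod_(u | u != s) side2 rho' y y' (K u) =
          (vt y * vt y') ^+ m.-1 * \prod_(u | u != s) side2 rho y y' (K u).
  have -> : (vt y * vt y') ^+ m.-1 = \prod_(u : 'I_m | u != s) (vt y * vt y').
    by rewrite prodr_const cardC1 card_ord.
  rewrite -big_split /=; apply: eq_bigr => u us.
  have ne w : injective (upd K s w) -> K u != w.
    move=> iw; apply/eqP => e; move/eqP: (us); apply; apply: iw.
    by rewrite upd_eq (upd_neq _ _ us).
  rewrite /side2 !sE ?ne //.
  transitivity (kappa ^+ 2 * vt (K u) ^+ 2 *
    (vt y * vt y' * (side rho (K u) y * side rho (K u) y'))); first by ring.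
  by rewrite k2 v2 !mul1r.
set A := p _ * _; set B := \prod_(u | _) _; set V := (_ * _) ^+ m.-1 => h.
rewrite /=; suff -> : A * (theta y * vt y ^+ m.-1 * (theta y' * vt y' ^+ m.-1)) * (V * B)
   = A * (theta y * theta y') * B by [].
have : V ^+ 2 = 1 by rewrite /V exprAC (exprMn 2 (vt y) (vt y')) !v2 mulr1 expr1n.
rewrite /V exprMn => e; rewrite -[RHS]mulr1 -e; ring.
Qed.

End Oriented.

(** * Partial sums of the exchange relation *)

Section Flip.
Variables (N : nat).
Implicit Types (rho : 'I_N -> nat) (c : nat).

(* The circle read counterclockwise, starting from the cut just before [c]. *)
Definition flip rho c (e : 'I_N) : nat :=
  let B := (\max_e' rho e')%N in
  (if rho e < c then B - rho e else B.*2.+1 - rho e)%N.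

Lemma leq_max_rho rho e : (rho e <= \max_e' rho e')%N.
Proof. exact: leq_bigmax. Qed.

Lemma flip_inj rho c : injective rho -> injective (flip rho c).
Proof.
move=> irho e y; rewrite /flip => h; apply: irho; move: h.
have := leq_max_rho rho e; have := leq_max_rho rho y.
by case: ifP; case: ifP; lia.
Qed.

Lemma flip_le rho c e y : (c <= rho e)%N -> (c <= rho y)%N ->
  (flip rho c e <= flip rho c y)%N = (rho y <= rho e)%N.
Proof.
have := leq_max_rho rho e; have := leq_max_rho rho y.
by rewrite /flip; case: ifP; case: ifP; lia.
Qed.

Lemma flip_lt rho c e y : (rho e < c)%N -> (c <= rho y)%N ->
  (flip rho c e < flip rho c y)%N.
Proof.
have := leq_max_rho rho e; have := leq_max_rho rho y.
by rewrite /flip; case: ifP; case: ifP; lia.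
Qed.

(** Reversal changes every [side] by -1, except for pairs separated by the cut, which keep their
    order; the signs of their endpoints multiply to -1 and correct this. *)
Lemma flip_oriented (R : realFieldType) m (X : 'M[R]_(N, m)) rho c theta :
  injective rho -> oriented X rho theta ->
  oriented X (flip rho c)
    (fun e => theta e * (if (rho e < c)%N then 1 else -1) ^+ m.-1).
Proof.
move=> irho o; apply: (oriented_change (kappa := -1) o).
- by rewrite sqrrN expr1n.
- by move=> e; case: ifP; rewrite ?sqrrN expr1n.
move=> e y ey; have : rho e != rho y by rewrite (inj_eq irho).
have := leq_max_rho rho e; have := leq_max_rho rho y.
rewrite /side /flip.
case: (ltnP (rho e) c) => hc; case: (ltnP (rho y) c) => hy;
  case: (ltnP (rho e) (rho y)) => he; case: ifP => hf h1 h2 h3;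
  rewrite ?(mulr1, mul1r, mulrN, mulNr, opprK) //; exfalso; lia.
Qed.

End Flip.

Section Tail.
Variables (R : realFieldType) (N m : nat) (X : 'M[R]_(N, m)).
Implicit Types (K I J : 'I_m -> 'I_N) (s t : 'I_m) (rho : 'I_N -> nat).
Implicit Types (theta : 'I_N -> R) (e x y z : 'I_N).

Local Notation p := (minor X).

(* Replacing [J t1] by [I s1] makes the pair closer; the correction term is a
   partial sum for the pair obtained by moreover moving [J t1] into [I]. *)
Lemma exchange_recursion I J s s1 t1 (P : pred 'I_m) :
  injective I -> injective J -> s1 != s -> I s \notin range J ->
  J t1 \notin range I ->
  P t1 ->
  p (upd J t1 (I s1)) *
    (\sum_(t | (J t \notin range I) && P t) p (upd I s (J t)) * p (upd J t (I s)))
  = p J * (\sum_(t | [&& J t \notin range I, P t & t != t1])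
             p (upd I s (J t)) * p (upd (upd J t1 (I s1)) t (I s)))
  - p (upd J t1 (I s)) *
    (\sum_(t | (J t \notin range I) && ~~ P t) p (upd I s (J t)) * p (upd J t (I s1))).
Proof.
move=> iI iJ s1s sJ t1I Pt1.
have zero : \sum_t p (upd I s (J t)) * p (upd J t (I s1)) = 0.
  have := minor_exchange X (upd I s (I s1)) J s.
  rewrite upd_eq (@minor_alt _ _ _ _ _ s s1) ?mul0r; last by rewrite upd_eq upd_neq.
    by under eq_bigr do rewrite upd_upd.
  by rewrite eq_sym.
have common t : J t \in range I -> p (upd I s (J t)) = 0.
  move=> /rangeP[u eu]; have us : s != u.
    by apply: contraNneq sJ => ->; rewrite -eu mem_range.
  by apply: (minor_alt _ us); rewrite upd_eq upd_neq // eq_sym.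
move: zero; rewrite (bigID (fun t => J t \notin range I)) /= [X in _ + X]big1 ?addr0;
  last by move=> t; rewrite negbK => /common ->; rewrite mul0r.
rewrite (bigID P) /= addrC => /eqP; rewrite addr_eq0 => /eqP ->.
rewrite mulrN opprK !mulr_sumr.
rewrite (bigD1 t1) ?t1I //= [X in _ = _ + X](bigD1 t1) ?t1I //=.
rewrite [RHS]addrCA; congr (_ + _); first by ring.
rewrite [X in _ = X + _](eq_bigl (fun t => (J t \notin range I) && P t && (t != t1)));
  last by move=> t; rewrite andbA.
rewrite -big_split /=.
apply: eq_bigr => t /andP[_ tt1].
rewrite mulrCA minor_three_term //; ring.
Qed.

(** Induction through [exchange_recursion]: the induction hypothesis signs both sums on its
    right-hand side, and [oriented_crossing] and [oriented_noncrossing] sign their coefficients. The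
    count keeps the tail short enough for both uses. *)
Lemma tail_ge0 rho theta I J s t0 c :
  injective rho -> oriented X rho theta -> injective I -> injective J ->
  I s \notin range J -> J t0 \notin range I ->
  {in range I :\: range J, forall e, rho e < c}%N ->
  {in range J :\: range I, forall e, c <= rho e}%N ->
  (#|[set e in range J :\: range I | (rho (J t0) <= rho e)%N]|
   <= #|[set e in range I :\: range J | (rho e < rho (I s))%N]|)%N ->
  0 <= p (upd I s (J t0)) * p (upd J t0 (I s)) *
    \sum_(t | (J t \notin range I) && (rho (J t0) <= rho (J t))%N)
       p (upd I s (J t)) * p (upd J t (I s)).
Proof.
have [n] := ubnP #|range J :\: range I|.
elim: n => // n IH in rho theta I J s t0 c *.
move=> /ltnSE-cn irho o iI iJ sJ t0I Ic Jc cnt.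
(* [J t1] is the last element of J \ I; if it is [J t0], the sum has one term and the product is a
   square. *)
have [t1 t1I t1max] := arg_maxnP (P := fun t => J t \notin range I) (fun t => rho (J t)) t0I.
have {}t1max t : J t \notin range I -> (rho (J t) <= rho (J t1))%N := t1max t.
have [t01|t01] := eqVneq t0 t1.
  rewrite (bigD1 t0) ?t0I //= big1 => [|t /andP[/andP[tI t0t] tt0]].
    by rewrite addr0 -expr2 sqr_ge0.
  have := t1max t tI; rewrite -t01 => tt; case/eqP: tt0; apply/iJ/irho/eqP.
  by rewrite eqn_leq tt t0t.
have l01 : (rho (J t0) < rho (J t1))%N.
  rewrite ltn_neqAle (inj_eq irho) (inj_eq iJ) t01; exact: t1max.
(* [I s1] is the first element of I \ J; it precedes [I s] because the count leaves at least one
   element before [I s]. *)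
have [s1 s1J s1min] := arg_minnP (P := fun t => I t \notin range J) (fun t => rho (I t)) sJ.
have inD (K L : 'I_m -> 'I_N) t : K t \notin range L -> K t \in range K :\: range L.
  by rewrite inE mem_range andbT.
have s1s : (rho (I s1) < rho (I s))%N.
  have : (0 < #|[set e in range I :\: range J | (rho e < rho (I s))%N]|)%N.
    by apply: leq_trans cnt; apply/card_gt0P; exists (J t0); rewrite in_set inD /=.
  case/card_gt0P => e; rewrite !inE => /andP[/andP[eJ /rangeP[u eu]] h].
  by apply: leq_ltn_trans h; rewrite eu; apply: s1min; rewrite -eu.
have s1s' : s1 != s by apply: contraTneq s1s => ->; rewrite ltnn.
pose J' := upd J t1 (I s1).
have iJ' : injective J' by exact: upd_inj_range.
have rJ' : range J' = I s1 |: range J :\ J t1 by exact: range_upd.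
have sJ' : I s \notin range J'.
  by rewrite rJ' !inE (inj_eq iI) eq_sym (negPf s1s') (negPf sJ) andbF.
have DJ' : range J' :\: range I = (range J :\: range I) :\ J t1.
  apply/setP => e; rewrite rJ' !inE; case: eqP => [->|_]; first by rewrite mem_range andbF.
  by rewrite andbCA.
have DI' : range I :\: range J' = (range I :\: range J) :\ I s1.
  apply/setP => e; rewrite rJ' !inE negb_or negb_and negbK.
  have [->|_] := eqVneq e (J t1); first by rewrite (negPf t1I) !andbF.
  by rewrite -andbA.
have J't t : t != t1 -> J' t = J t by exact: upd_neq.
(* Passing to [J'] removes [J t1] from the tail and [I s1] from the elements before [I s], so both
   counts drop by one. *)
have IH1 : 0 <= p (upd I s (J t0)) * p (upd J' t0 (I s)) *
    \sum_(t | [&& J t \notin range I, (rho (J t0) <= rho (J t))%N & t != t1])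
       p (upd I s (J t)) * p (upd J' t (I s)).
  rewrite (_ : \sum_(t | _) _ = \sum_(t | (J' t \notin range I)
      && (rho (J t0) <= rho (J' t))%N) p (upd I s (J' t)) * p (upd J' t (I s))); last first.
    apply: eq_big => t; last by case/and3P => _ _ h; rewrite J't.
    have [->|h] := eqVneq t t1; last by rewrite J't // andbT.
    by rewrite /J' upd_eq mem_range !andbF.
  have := IH rho theta I J' s t0 c; rewrite DJ' DI' (J't _ t01); apply => //.
  - by move: cn; rewrite (cardsD1 (J t1)) inD.
  - by move=> e /setD1P[_ /Ic].
  - by move=> e /setD1P[_ /Jc].
  have m1 : J t1 \in [set e in range J :\: range I | (rho (J t0) <= rho e)%N].
    by rewrite in_set inD //= ltnW.
  have m2 : I s1 \in [set e in range I :\: range J | (rho e < rho (I s))%N].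
    by rewrite in_set inD.
  move: cnt; rewrite (cardsD1 (J t1)) m1.
  rewrite (cardsD1 (I s1) [set e in _ | (_ < rho (I s))%N]) m2 !add1n ltnS.
  have -> : [set e in (range J :\: range I) :\ J t1 | (rho (J t0) <= rho e)%N]
    = [set e in range J :\: range I | (rho (J t0) <= rho e)%N] :\ J t1.
    by apply/setP => e; rewrite !inE; rewrite -!andbA.
  have -> // : [set e in (range I :\: range J) :\ I s1 | (rho e < rho (I s))%N]
    = [set e in range I :\: range J | (rho e < rho (I s))%N] :\ I s1.
    by apply/setP => e; rewrite !inE; rewrite -!andbA.
set H := \sum_(t | (J t \notin range I) && ~~ (rho (J t0) <= rho (J t))%N)
  p (upd I s (J t)) * p (upd J t (I s1)).
have z1 := s1J.
have xy t : J t \notin range I -> (rho (I s) < rho (J t))%N.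
  by move=> tI; apply: leq_trans (Ic _ (inD _ _ _ sJ)) (Jc _ (inD _ _ _ tI)).
have zy t : J t \notin range I -> (rho (I s1) < rho (J t))%N.
  by move=> tI; apply: ltn_trans s1s (xy _ tI).
have cr := oriented_crossing o iJ sJ z1 t01 s1s (xy _ t0I) l01.
have nc := oriented_noncrossing o iJ sJ z1 t01 s1s (xy _ t0I) l01.
(* If [H] is not empty, let [J t2] be the element of J \ I just before [J t0]. Read backwards, [H]
   is a tail starting at [t2], whose term has the sign opposite to that at [t0]. *)
have IH2 : 0 <= - (p (upd I s (J t0)) * p (upd J t0 (I s1))) * H.
  have [t3 /andP[t3I t30] | none] := pickP (fun t => (J t \notin range I)
      && ~~ (rho (J t0) <= rho (J t))%N); last by rewrite /H big_pred0 // mulr0.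
  have [t2 /andP[t2I t20] t2max] := arg_maxnP (P := fun t => (J t \notin range I)
      && ~~ (rho (J t0) <= rho (J t))%N) (fun t => rho (J t)) (i0 := t3)
      (introT andP (conj t3I t30)).
  have {}t2max t : J t \notin range I -> (rho (J t) < rho (J t0))%N ->
      (rho (J t) <= rho (J t2))%N.
    by move=> tI tt0; apply: t2max; rewrite tI -ltnNge.
  rewrite -ltnNge in t20.
  have t21 : t2 != t1 by apply: contraTneq (ltn_trans t20 l01) => ->; rewrite ltnn.
  have alt : p (upd I s (J t2)) * p (upd J t2 (I s1)) *
      (p (upd I s (J t0)) * p (upd J t0 (I s1))) < 0.
    apply: (oriented_alternates o irho iI iJ) => //; [exact: xy | exact: zy |].
    move=> e /andP[e2 e0]; apply/idP/idP => [eI|].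
      apply: contraTT (ltnW e2) => eJ; rewrite -ltnNge.
      by apply: leq_trans (Jc _ (inD _ _ _ t2I)); apply: Ic; rewrite inE eJ.
    move=> /rangeP[u eu]; apply: contraTT e2 => eI; rewrite -leqNgt eu.
    by apply: t2max; rewrite -eu.
  apply: (@same_sign_ge0 _ _ (p (upd I s (J t2)) * p (upd J t2 (I s1)))).
    by rewrite mulNr oppr_gt0 mulrC.
  pose I' := upd I s (J t1).
  have iI' : injective I' by exact: upd_inj_range.
  have rI' : range I' = J t1 |: range I :\ I s by exact: range_upd.
  have I'D t : t != t1 -> (J t \in range I') = (J t \in range I).
    move=> tt1; rewrite rI' !inE (inj_eq iJ) (negPf tt1) /=.
    by case: eqP => // e; rewrite -e mem_range in sJ.
  have DJ2 : range J' :\: range I' = (range J :\: range I) :\ J t1.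
    apply/setP => e; rewrite rI' rJ' !inE.
    have [->|_] //= := eqVneq e (J t1).
    have [->|_] /= := eqVneq e (I s1); first by rewrite inj_eq // s1s' mem_range.
    by have [->|_] //= := eqVneq e (I s); rewrite (negPf sJ) andbF.
  have DI2 : range I' :\: range J' = J t1 |: (range I :\: range J) :\ I s :\ I s1.
    apply/setP => e; rewrite rI' rJ' !inE.
    have [->|_] /= := eqVneq e (J t1).
      by rewrite orbF eq_sym (notin_range _ t1I).
    by case: (e == I s); case: (e == I s1); case: (e \in range I);
      case: (e \in range J).
  have flle y y' : y \in range J :\: range I -> y' \in range J :\: range I ->
      (flip rho c y <= flip rho c y')%N = (rho y' <= rho y)%N.
    by move=> /Jc hy /Jc hy'; rewrite flip_le.
  have fllt e y : e \in range I :\: range J -> y \in range J :\: range I ->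
      (flip rho c e < flip rho c y)%N.
    by move=> /Ic he /Jc hy; rewrite flip_lt.
  have swap t : t != t1 -> p (upd J' t (J t1)) = - p (upd J t (I s1)).
    by move=> tt1; rewrite minor_swap 1?eq_sym // upd_id.
  have -> : p (upd I s (J t2)) * p (upd J t2 (I s1)) * H =
     p (upd I' s (J' t2)) * p (upd J' t2 (I' s)) *
     \sum_(t | (J' t \notin range I') && (flip rho c (J' t2) <= flip rho c (J' t))%N)
       p (upd I' s (J' t)) * p (upd J' t (I' s)).
    rewrite (J't _ t21) /I' upd_upd upd_eq swap // mulrN mulNr -mulrN -sumrN -/I'.
    congr (_ * _); apply: eq_big => t.
      have [->|tt1] := eqVneq t t1.
        rewrite [J' t1]upd_eq -[I s1](@upd_neq _ _ I s (J t1)) // mem_range.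
        by rewrite (ltnW l01) andbF.
      rewrite J't // I'D //; case: (boolP (J t \in _)) => //= tI.
      rewrite flle ?inD // -ltnNge; apply/idP/idP; first exact: t2max.
      by move=> h; apply: leq_ltn_trans t20.
    move=> /andP[tI h]; have tt1 : t != t1.
      by apply: contraNneq h => ->; exact: ltnW.
    by rewrite J't // swap // upd_upd mulrN opprK.
  (* [J t1] now belongs to [I'] and is the last of I' \ J' in the flipped reading, so the separating
     cut lies just after it. *)
  have Q := (IH _ _ I' J' s t2 (flip rho c (J t1)).+1 _ (flip_inj (c:=c) irho) (flip_oriented c irho o)). apply: Q => //.
  - by move: cn; rewrite DJ2 (cardsD1 (J t1)) inD.
  - by rewrite /I' upd_eq rJ' !inE eqxx orbF eq_sym (notin_range _ t1I).
  - by rewrite J't // I'D.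
  - move=> e; rewrite DI2 => /setU1P[->|/setD1P[_ /setD1P[_ h]]] //.
    by apply: ltnW; rewrite ltnS; apply: fllt => //; exact: inD.
  - move=> e; rewrite DJ2 => /setD1P[et1 eD]; rewrite ltnNge flle ?inD // -ltnNge.
    rewrite ltn_neqAle (inj_eq irho) et1 /=.
    move: eD; rewrite inE => /andP[eI /rangeP[u eu]]; rewrite eu in eI *.
    exact: t1max.
  rewrite DI2 DJ2 J't // /I' upd_eq -/I'.
  (* All of I \ J except [I s] and [I s1] comes before [J t1] in the flipped reading. The part of J
     \ I before [J t0] is no larger, since it misses at least [J t0] and [J t1]. *)
  have card2 : (#|range I :\: range J| =
      #|[set e in range J :\: range I | (rho (J t0) <= rho e)%N]|
      + #|[set e in range J :\: range I | ~~ (rho (J t0) <= rho e)%N]|)%N.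
    rewrite card_rangeD // -(cardsID [set e | (rho (J t0) <= rho e)%N]).
    by congr (_ + _)%N; apply: eq_card => e; rewrite !inE // andbC.
  have card3 : (1 < #|[set e in range J :\: range I | (rho (J t0) <= rho e)%N]|)%N.
    apply/card_gt1P; exists (J t0), (J t1); split; last by rewrite (inj_eq iJ).
      by rewrite in_set inD /=.
    by rewrite in_set inD //= ltnW.
  have m2 : I s1 \in (range I :\: range J) :\ I s.
    by rewrite in_setD1 (inj_eq iI) s1s' inD.
  move: card2; rewrite (cardsD1 (I s)) inD // (cardsD1 (I s1) (_ :\ I s)) m2 => card2.
  apply: (@leq_trans #|(range I :\: range J) :\ I s :\ I s1|); last first.
    apply: subset_leq_card; apply/subsetP => e eD; rewrite inE.
    rewrite in_setU1 eD orbT /=; move: eD => /setD1P[_ /setD1P[_ h]].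
    by apply: fllt => //; exact: inD.
  apply: (@leq_trans #|[set e in range J :\: range I | ~~ (rho (J t0) <= rho e)%N]|);
    last first.
    rewrite -(leq_add2l 2).
    have -> : (2 + #|(range I :\: range J) :\ I s :\ I s1|)%N = _ := card2.
    by rewrite leq_add2r.
  apply: subset_leq_card; apply/subsetP => e; rewrite in_set => /andP[/setD1P[_ eD]].
  by rewrite flle ?inD // inE eD /= -ltnNge => h; apply: leq_ltn_trans t20.
have rec := @exchange_recursion I J s s1 t1 (fun t => (rho (J t0) <= rho (J t))%N)
  iI iJ s1s' sJ t1I (ltnW l01).
rewrite -/J' -/H in rec.
set S := \sum_(t | _) _; set S' := \sum_(t | _) _ in IH1 rec; rewrite -/S in rec.
set a := p (upd I s (J t0)) in IH1 IH2 *.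
rewrite -/J' in cr nc.
have J'0 : p J' != 0 by apply: contraTneq cr => ->; rewrite !mul0r ltxx.
rewrite -(@pmulr_rge0 _ (p J' ^+ 2)) ?exprn_even_gt0 //.
have -> : p J' ^+ 2 * (a * p (upd J t0 (I s)) * S) =
   p J' * (a * p (upd J t0 (I s))) * (p J' * S) by ring.
have a0 : 0 < a ^+ 2.
  by rewrite exprn_even_gt0 //= (oriented_neq0 s o) //; exact: upd_inj_range.
rewrite rec mulrBr addr_ge0 //.
  rewrite [X in 0 <= X]mulrA; apply: same_sign_ge0 IH1.
  rewrite [X in 0 < X](_ : _ = a ^+ 2 *
    (p J' * p (upd J t0 (I s)) * (p J * p (upd J' t0 (I s))))); last by ring.
  by rewrite mulr_gt0.
rewrite -mulNr [X in 0 <= X]mulrA; apply: same_sign_ge0 IH2.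
rewrite [X in 0 < X](_ : _ = a ^+ 2 * (p J' * p (upd J t0 (I s)) *
    (p (upd J t1 (I s)) * p (upd J t0 (I s1))))); last by ring.
by rewrite mulr_gt0.
Qed.

End Tail.

(** * Vandermonde matrices and total positivity *)

Section Increasing.
Variables (N m : nat).
Implicit Types (K : 'I_m -> 'I_N).

Definition increasing K := forall u v : 'I_m, (u < v)%N -> (K u < K v)%N.

Lemma increasing_inj K : increasing K -> injective K.
Proof.
move=> inc u v e; apply/eqP; case: (ltngtP u v) => [/inc|/inc|/val_inj->] //;
  by rewrite e ltnn.
Qed.

Lemma exists_sorting K : injective K -> exists w : 'S_m, increasing (K \o w).
Proof.
move=> iK; pose r := fun a b : 'I_N => (a <= b)%N.
pose s := sort r [tuple K u | u < m].
have ss : sorted r s by apply: sort_sorted => a b; exact: leq_total.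
have /tuple_permP[w ew] : perm_eq s [tuple K u | u < m] by rewrite perm_sort.
exists w => u v uv; have sz : size s = m by rewrite size_sort size_tuple.
have nE (t : 'I_m) : nth (K u) s t = K (w t).
  rewrite ew (nth_map t) ?size_enum_ord // nth_ord_enum.
  by rewrite tnth_mktuple.
rewrite /= ltn_neqAle -!nE; apply/andP; split.
  by rewrite !nE val_eqE (inj_eq iK) (inj_eq perm_inj) neq_ltn uv.
apply: (sorted_leq_nth (leT := r)) => //; rewrite ?inE ?sz ?ltn_ord //; last exact: ltnW.
by move=> a b c; exact: leq_trans.
Qed.

End Increasing.

Section Vandermonde.
Variables (R : realFieldType) (N m : nat).
Implicit Types (K : 'I_m -> 'I_N) (x v : 'I_N -> R) (X : 'M[R]_(N, m)).

Definition vdm x : 'M[R]_(N, m) := \matrix_(e, b) x e ^+ b.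

Lemma minor_vdm x K :
  minor (vdm x) K = \prod_(u < m) \prod_(t < m | (u < t)%N) (x (K t) - x (K u)).
Proof.
rewrite /minor -det_tr (_ : _^T = Vandermonde m (\row_u x (K u))); last first.
  by apply/matrixP => a b; rewrite !mxE.
by rewrite det_Vandermonde; apply: eq_bigr => u _; apply: eq_bigr => t _; rewrite !mxE.
Qed.

(** As a function of the node of the replaced row, the minor is a polynomial of degree less than [m]
    vanishing at the [m.-1] distinct nodes of the other rows; the quotient by these roots is
    constant. *)
Lemma minor_vdm_upd x K s :
  {in predC1 s &, injective (x \o K)} ->
  exists C, forall y,
    minor (vdm x) (upd K s y) = C * \prod_(u | u != s) (x y - x (K u)).
Proof.
move=> inj; pose A := \adj (rowsub K (vdm x)).
pose g := \sum_(b < m) (A b s)%:P * 'X^b.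
have gE y : minor (vdm x) (upd K s y) = g.[x y].
  rewrite minor_upd !mxE horner_sum; apply: eq_bigr => b _.
  by rewrite hornerM hornerC hornerXn !mxE mulrC.
have sg : (size g <= m)%N.
  apply: leq_trans (size_sum _ _ _) _; apply/bigmax_leqP => b _.
  by rewrite mul_polyC (leq_trans (size_scale_leq _ _)) // size_polyXn.
pose rs := [seq x (K u) | u <- enum (predC1 s)].
have urs : uniq_roots rs.
  rewrite uniq_rootsE map_inj_in_uniq ?enum_uniq // => u t.
  by rewrite !mem_enum => us ts; exact: (inj _ _ us ts).
have rrs : all (root g) rs.
  apply/allP => z /mapP[u]; rewrite mem_enum inE => us ->; apply/rootP.
  by rewrite -gE (minor_alt _ us) // upd_eq upd_neq.
have [q gq] := uniq_roots_prod_XsubC rrs urs.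
have prodE y : (\prod_(z <- rs) ('X - z%:P)).[y] = \prod_(u | u != s) (y - x (K u)).
  rewrite horner_prod big_map big_enum /=; apply: eq_bigr => u _.
  by rewrite hornerXsubC.
have sq : (size q <= 1)%N.
  have [->|q0] := eqVneq q 0; first by rewrite size_poly0.
  move: sg; rewrite gq size_Mmonic ?monic_prod_XsubC // size_prod_XsubC size_map -cardE.
  rewrite cardC1 card_ord; have m0 : (0 < m)%N by apply: leq_trans (ltn_ord s).
  by rewrite prednK //; move: (size q) m0 => k; lia.
exists q`_0 => y; rewrite gE gq hornerM prodE; congr (_ * _).
by rewrite (size1_polyC sq) hornerC coefC.
Qed.

Definition totally_positive X := forall K, increasing K -> 0 < minor X K.

Lemma minor_sign X K : totally_positive X -> injective K ->
  exists w : 'S_m, increasing (K \o w) /\ 0 < (-1) ^+ w * minor X K.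
Proof.
move=> tp iK; have [w inc] := exists_sorting iK.
by exists w; split=> //; rewrite -minor_comp_perm; exact: tp.
Qed.

Lemma same_sign_minors X Y K : totally_positive X -> totally_positive Y ->
  injective K -> 0 < minor X K * minor Y K.
Proof.
move=> tX tY iK; have [w inc] := exists_sorting iK.
have := mulr_gt0 (tX _ inc) (tY _ inc).
by rewrite !minor_comp_perm mulrACA -expr2 sqrr_sign mul1r.
Qed.

Lemma vdm_gt0 x K : (forall u t : 'I_m, (u < t)%N -> x (K u) < x (K t)) ->
  0 < minor (vdm x) K.
Proof.
move=> inc; rewrite minor_vdm; apply: prodr_gt0 => u _; apply: prodr_gt0 => t ut.
by rewrite subr_gt0 inc.
Qed.

(** The sign of a minor is that of its sorting permutation, hence the same for all totally positive
    matrices. For the Vandermonde matrix with nodes 0, 1, ... it is visible factor by factor. *)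
Lemma totally_positive_oriented X : totally_positive X ->
  oriented X val (fun=> 1).
Proof.
move=> tp K s y y' iy iy'; rewrite !mulr1.
pose x (e : 'I_N) : R := e%:R; pose V := vdm x.
have tV : totally_positive V.
  by move=> L inc; apply: vdm_gt0 => u t /inc; rewrite ltr_nat.
have := mulr_gt0 (same_sign_minors tp tV iy) (same_sign_minors tp tV iy').
rewrite mulrACA => h; apply: same_sign_trans h _.
have [|C CE] := @minor_vdm_upd x K s.
  move=> u t; rewrite !inE => us ts /= e; apply: iy; rewrite !upd_neq //.
  by apply/val_inj/eqP; rewrite -(eqr_nat R); apply/eqP.
have V0 : minor V (upd K s y) != 0.
  by have := same_sign_minors tp tV iy; apply: contraTneq => ->; rewrite mulr0 ltxx.
rewrite !CE; set P1 := \prod_(u | _) _; set P2 := \prod_(u | _) _; set P3 := \prod_(u | _) _.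
have -> : C * P1 * (C * P2) * P3 = C ^+ 2 * (P1 * P2 * P3) by ring.
rewrite mulr_gt0 //.
  by rewrite exprn_even_gt0 //; apply: contraNneq V0; rewrite CE => ->; rewrite mul0r.
rewrite -!big_split /=.
apply: prodr_gt0 => u us.
have ne (w : 'I_N) : injective (upd K s w) -> K u != w :> nat.
  move=> iw; apply/eqP => /val_inj e; move/eqP: (us); apply; apply: iw.
  by rewrite upd_eq (upd_neq _ _ us).
have pos (w : 'I_N) : K u != w :> nat -> 0 < (x w - x (K u)) * side R val (K u) w.
  rewrite neq_ltn /side /x; case: (ltnP (K u) w) => [h _|h /= h']; rewrite ?(mulr1, mulrN1).
    by rewrite subr_gt0 ltr_nat.
  by rewrite opprB subr_gt0 ltr_nat.
by rewrite /side2 mulrACA mulr_gt0 // pos // ne.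
Qed.

(** Each index lies in exactly [m.-1] pairs. *)
Lemma prod_pairs (v : 'I_m -> R) :
  \prod_(u < m) \prod_(t < m | (u < t)%N) (v u * v t) = \prod_(u < m) v u ^+ m.-1.
Proof.
under eq_bigr do rewrite big_split.
rewrite big_split /= [X in _ * X](exchange_big_dep predT) //= -big_split /=.
apply: eq_bigr => u _; transitivity (\prod_(t < m | t != u) v u).
  rewrite [RHS](bigID (fun t : 'I_m => (u < t)%N)) /=; congr (_ * _); apply: eq_bigl => t;
    by rewrite -(inj_eq val_inj) /= neq_ltn; case: (ltngtP u t).
by rewrite prodr_const cardC1 card_ord.
Qed.

Lemma minor_scale_rows X v K :
  minor (\matrix_(e, b) (v e * X e b)) K = \prod_u v (K u) * minor X K.
Proof.
pose D := diag_mx (\row_u v (K u)).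
rewrite (_ : \prod_u _ = \det D) -?det_mulmx; last first.
  by rewrite det_diag; apply: eq_bigr => u _; rewrite mxE.
by congr (\det _); apply/matrixP => a b; rewrite mul_diag_mx !mxE.
Qed.

(* The sign [v] records on which side of a cut a point lies; rotating the circle
   past a point multiplies the maximal minors through it by [(-1) ^+ m.-1]. *)
Lemma rotated_vdm_gt0 x v K : (forall e, v e ^+ 2 = 1) ->
  (forall u t : 'I_m, (u < t)%N -> 0 < v (K u) * v (K t) * (x (K t) - x (K u))) ->
  0 < minor (\matrix_(e, b) (v e ^+ m.-1 * vdm x e b)) K.
Proof.
move=> v2 pos; rewrite minor_scale_rows -(prod_pairs (v \o K)) minor_vdm.
rewrite -big_split; apply: prodr_gt0 => u _; rewrite -big_split.
by apply: prodr_gt0 => t; exact: pos.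
Qed.

End Vandermonde.

(** * The circle cut open at a point *)

Section CwDist.
Variables (R : realFieldType) (N : nat).
Implicit Types (a x y : 'I_N).

Lemma cw_distE a x : cw_dist a x = (if a <= x then x - a else x + N - a)%N.
Proof.
have aN := ltn_ord a; have xN := ltn_ord x; rewrite /cw_dist; case: leqP => h.
  have -> : (x + (N - a) = (x - a) + N)%N by lia.
  by rewrite modnDr modn_small //; lia.
by rewrite modn_small; lia.
Qed.

Lemma cw_dist_inj a : injective (cw_dist a).
Proof.
move=> x y; rewrite !cw_distE => e; apply: val_inj => /=; move: e.
have aN := ltn_ord a; have xN := ltn_ord x; have yN := ltn_ord y.
by case: ifP; case: ifP; lia.
Qed.

Definition cut_sign a x : R := if (x < a)%N then -1 else 1.

Lemma cut_sign_sq a x : cut_sign a x ^+ 2 = 1.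
Proof. by rewrite /cut_sign; case: ifP; rewrite ?sqrrN expr1n. Qed.

(** Starting at [a] reverses the order of exactly those pairs that the cut before [a] separates, and
    for these the cut signs multiply to -1. *)
Lemma cw_dist_oriented m (X : 'M[R]_(N, m)) a : totally_positive X ->
  oriented X (cw_dist a) (fun e => 1 * cut_sign a e ^+ m.-1).
Proof.
move=> tp; apply: (oriented_change (kappa := 1) (totally_positive_oriented tp)).
- by rewrite expr1n.
- exact: cut_sign_sq.
move=> x y; rewrite -(inj_eq val_inj) /= => xy.
have aN := ltn_ord a; have xN := ltn_ord x; have yN := ltn_ord y.
rewrite /side /cut_sign !cw_distE.
case: (leqP a x) => hx; case: (leqP a y) => hy; case: (ltnP x y) => h;
  case: ifP => h'; rewrite ?(mulr1, mul1r, mulrN, mulNr, opprK) //; exfalso; lia.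
Qed.

End CwDist.

(** * Initial and final sums for separated sets *)

Section PartialSums.
Variables (R : realFieldType) (N m : nat) (X : 'M[R]_(N, m)).
Variables (rho : 'I_N -> nat) (theta : 'I_N -> R) (I J : 'I_m -> 'I_N) (c : nat).
Hypotheses (irho : injective rho) (o : oriented X rho theta).
Hypotheses (iI : injective I) (iJ : injective J).
Hypothesis Ic : {in range I :\: range J, forall e, rho e < c}%N.
Hypothesis Jc : {in range J :\: range I, forall e, c <= rho e}%N.

Local Notation p := (minor X).

(** In the exchange relation a term with [J t] in [I] has a repeated row and vanishes. *)
Lemma exchange_sum s (P : pred 'I_m) : I s \notin range J ->
  \sum_(t | (J t \notin range I) && P t) p (upd I s (J t)) * p (upd J t (I s))
  + \sum_(t | (J t \notin range I) && ~~ P t) p (upd I s (J t)) * p (upd J t (I s))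
  = p I * p J.
Proof.
move=> sJ; rewrite -(bigID P) -(minor_exchange X I J s) [RHS](bigID (fun t => J t \notin range I)).
rewrite /= [X in _ = _ + X]big1 ?addr0 // => t; rewrite negbK => /rangeP[u eu].
have us : s != u by apply: contraNneq sJ => ->; rewrite -eu mem_range.
by rewrite (minor_alt _ us) ?mul0r // upd_eq upd_neq // eq_sym.
Qed.

(** Flipping at [c] keeps I \ J before J \ I and reverses each, so the initial segment becomes a
    tail. *)
Lemma head_ge0 s t0 : I s \notin range J -> J t0 \notin range I ->
  (#|[set e in range J :\: range I | (rho e <= rho (J t0))%N]|
   <= #|[set e in range I :\: range J | (rho (I s) < rho e)%N]|)%N ->
  0 <= p (upd I s (J t0)) * p (upd J t0 (I s)) *
    \sum_(t | (J t \notin range I) && (rho (J t) <= rho (J t0))%N)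
       p (upd I s (J t)) * p (upd J t (I s)).
Proof.
move=> sJ t0I cnt.
have inD (K L : 'I_m -> 'I_N) t : K t \notin range L -> K t \in range K :\: range L.
  by rewrite inE mem_range andbT.
have e1 y y' : y \in range J :\: range I -> y' \in range J :\: range I ->
    (flip rho c y <= flip rho c y')%N = (rho y' <= rho y)%N.
  by move=> /Jc hy /Jc hy'; rewrite flip_le.
rewrite (eq_bigl (fun t => (J t \notin range I) &&
    (flip rho c (J t0) <= flip rho c (J t))%N)); last first.
  by move=> t; case: (boolP (J t \in _)) => //= tI; rewrite e1 ?inD.
(* With B the maximum of [rho], the flipped I \ J lies in [0, B] and the flipped J \ I beyond B,
   which gives the cut B + 1. *)
apply: (@tail_ge0 _ _ _ _ _ _ I J s t0 (\max_e rho e).+1%N (@flip_inj _ _ c irho)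
  (flip_oriented c irho o)) => //.
- by move=> e /Ic h; rewrite /flip h ltnS leq_subr.
- by move=> e /Jc h; have := leq_max_rho rho e; rewrite /flip; case: ifP; lia.
have -> : [set e in range J :\: range I | (flip rho c (J t0) <= flip rho c e)%N]
  = [set e in range J :\: range I | (rho e <= rho (J t0))%N].
  apply/setP => e; rewrite 2!in_set; case: (boolP (e \in _)) => //= eD.
  by rewrite e1 ?inD.
apply: leq_trans cnt _; apply: subset_leq_card; apply/subsetP => e.
rewrite in_set => /andP[eD h]; rewrite in_set eD /=.
have h1 := Ic (inD _ _ _ sJ); have h2 := Ic eD.
by rewrite /flip h1 h2; have := leq_max_rho rho e; lia.
Qed.

(** The tail strictly after [J t0] has the sign of its own first term, which is opposite to the sign
    of the term at [t0] by alternation. *)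
Lemma tail_le0 s t0 : I s \notin range J -> J t0 \notin range I ->
  (#|[set e in range J :\: range I | (rho (J t0) < rho e)%N]|
   <= #|[set e in range I :\: range J | (rho e < rho (I s))%N]|)%N ->
  0 <= p (upd I s (J t0)) * p (upd J t0 (I s)) *
   - \sum_(t | (J t \notin range I) && ~~ (rho (J t) <= rho (J t0))%N)
       p (upd I s (J t)) * p (upd J t (I s)).
Proof.
move=> sJ t0I cnt.
have inD (K L : 'I_m -> 'I_N) t : K t \notin range L -> K t \in range K :\: range L.
  by rewrite inE mem_range andbT.
have [t3 /andP[t3I t30] | none] := pickP (fun t => (J t \notin range I)
      && ~~ (rho (J t) <= rho (J t0))%N); last by rewrite big_pred0 // oppr0 mulr0.
have [t1 /andP[t1I t10] t1min] := arg_minnP (P := fun t => (J t \notin range I)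
      && ~~ (rho (J t) <= rho (J t0))%N) (fun t => rho (J t)) (i0 := t3)
      (introT andP (conj t3I t30)).
rewrite -ltnNge in t10.
have t1le t : J t \notin range I ->
    ~~ (rho (J t) <= rho (J t0))%N = (rho (J t1) <= rho (J t))%N.
  move=> tI; apply/idP/idP => [h|]; last by rewrite -ltnNge; exact: leq_trans.
  by apply: t1min; rewrite tI.
have xy t : J t \notin range I -> (rho (I s) < rho (J t))%N.
  by move=> tI; apply: leq_trans (Ic (inD _ _ _ sJ)) (Jc (inD _ _ _ tI)).
have alt : p (upd I s (J t0)) * p (upd J t0 (I s)) *
    (p (upd I s (J t1)) * p (upd J t1 (I s))) < 0.
  apply: (oriented_alternates o irho iI iJ) => //; [exact: xy | exact: xy |].
  move=> e /andP[e0 e1]; apply/idP/idP => [eI|].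
    apply: contraTT (ltnW e0) => eJ; rewrite -ltnNge.
    by apply: leq_trans (Jc (inD _ _ _ t0I)); apply: Ic; rewrite inE eJ.
  move=> /rangeP[u eu]; apply: contraTT e1 => eI; rewrite -leqNgt eu.
  by rewrite -t1le -?eu // -ltnNge.
rewrite mulrN -mulNr.
apply: (@same_sign_ge0 _ _ (p (upd I s (J t1)) * p (upd J t1 (I s)))).
  by rewrite mulNr oppr_gt0.
rewrite (eq_bigl (fun t => (J t \notin range I) && (rho (J t1) <= rho (J t))%N)); last first.
  by move=> t; case: (boolP (J t \in _)) => //= tI; rewrite t1le.
apply: (tail_ge0 irho o iI iJ sJ t1I Ic Jc).
apply: leq_trans cnt; apply: subset_leq_card; apply/subsetP => e.
by rewrite !in_set => /andP[-> h] /=; apply: leq_trans h.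
Qed.

End PartialSums.

Section Labels.
Variables (N eta : nat) (rho : 'I_N -> nat) (f : 'I_eta -> 'I_N).
Hypothesis mono : forall k l : 'I_eta, (k < l)%N -> (rho (f k) < rho (f l))%N.

Lemma smono_lt k l : (rho (f k) < rho (f l))%N = (k < l)%N.
Proof.
case: (ltngtP k l) => [/mono //|/mono h|/val_inj ->]; last exact: ltnn.
by rewrite ltnNge ltnW.
Qed.

Lemma smono_le k l : (rho (f k) <= rho (f l))%N = (k <= l)%N.
Proof. by rewrite leqNgt smono_lt -leqNgt. Qed.

Lemma smono_inj : injective f.
Proof.
move=> k l e; apply/val_inj/eqP => /=; apply/negPn; rewrite neq_ltn -!smono_lt.
by rewrite e ltnn.
Qed.

Lemma card_ord_lt n : (n <= eta)%N -> #|[set k : 'I_eta | (k < n)%N]| = n.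
Proof.
move=> h; rewrite -sum1_card (eq_bigl (fun k : 'I_eta => (k < n)%N)).
  by rewrite (big_ord_narrow h) sum1_card card_ord.
by move=> k; rewrite inE.
Qed.

Lemma card_mono (P : pred 'I_eta) (Q : pred 'I_N) : (forall k, Q (f k) = P k) ->
  #|[set e in range f | Q e]| = #|[set k | P k]|.
Proof.
move=> QP; rewrite -(card_imset _ smono_inj); apply: eq_card => e; rewrite !inE.
apply/andP/imsetP => [[/rangeP[k ->] h]|[k]]; first by exists k; rewrite // inE -QP.
by rewrite inE -QP => h ->; rewrite mem_range.
Qed.

Lemma card_mono_lt l : #|[set e in range f | (rho e < rho (f l))%N]| = l.
Proof.
by rewrite (card_mono (P := fun k => (k < l)%N)) ?card_ord_lt // => [|k];
   [exact: ltnW | exact: smono_lt].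
Qed.

Lemma card_mono_le l : #|[set e in range f | (rho e <= rho (f l))%N]| = l.+1.
Proof.
rewrite (card_mono (P := fun k => (k < l.+1)%N)) ?card_ord_lt // => k.
by rewrite smono_le ltnS.
Qed.

Lemma card_mono_gt l : #|[set e in range f | (rho (f l) < rho e)%N]| = (eta - l.+1)%N.
Proof.
have := cardsC [set k : 'I_eta | (k < l.+1)%N]; rewrite card_ord_lt // card_ord.
rewrite (card_mono (P := fun k => (l < k)%N)); last exact: smono_lt.
have -> : ~: [set k : 'I_eta | (k < l.+1)%N] = [set k : 'I_eta | (l < k)%N].
  by apply/setP => k; rewrite !inE ltnNge negbK.
by move=> e; apply/eqP; rewrite -(eqn_add2l l.+1) e subnKC.
Qed.

End Labels.

Lemma sum_range (R : nmodType) N m (J : 'I_m -> 'I_N) (A : pred 'I_N) (F : 'I_N -> R) :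
  injective J -> \sum_(t | A (J t)) F (J t) = \sum_(y in range J | A y) F y.
Proof.
move=> iJ; rewrite [RHS]big_mkcondr big_imset /=; last by move=> ? ? _ _; exact: iJ.
by rewrite -big_mkcond.
Qed.

Section TupleSign.
Variables (N m : nat).
Implicit Types K : m.-tuple 'I_N.

Lemma range_tnth K : range (tnth K) = [set x in K].
Proof. by apply/setP => e; rewrite inE; apply/rangeP/tnthP. Qed.

Lemma tnth_replace K s y : uniq K -> tnth (replace_entry K (tnth K s) y) = upd (tnth K) s y.
Proof.
move=> uK; apply: funext => t; rewrite tnth_mktuple /upd.
by rewrite (inj_eq (tuple_uniqP K uK)).
Qed.

(** Sorting the rows multiplies the minor by the sign of the sorting permutation and yields a
    positive minor. *)
Lemma tuple_sgn_plucker (R : realFieldType) (X : 'M[R]_(N, m)) K :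
  totally_positive X -> injective (tnth K) -> 0 < tuple_sgn R K * plucker K X.
Proof.
move=> tp iK; rewrite /tuple_sgn; case: pickP => [w /forallP sw | none]; last first.
  have [w inc] := exists_sorting iK; have := none w.
  by move=> /negbT/negP[]; apply/forallP => u; apply/forallP => t; apply/implyP; exact: inc.
rewrite -[plucker K X]/(minor X (tnth K)) -minor_comp_perm; apply: tp => u t ut.
by move/forallP: (sw u) => /(_ t); rewrite ut.
Qed.

End TupleSign.

(** * Perturbation of totally nonnegative matrices *)

(** If [q] were negative at 0, then, being nonnegative at 1, it would take the negative value [q.[0]
    / 2] at some positive point. *)
Lemma poly_ge0_at0 (R : rcfType) (q : {poly R}) :
  (forall t, 0 < t -> 0 <= q.[t]) -> 0 <= q.[0].
Proof.
move=> pos; rewrite leNgt; apply/negP => q0.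
have q1 := pos 1 ltr01.
have [|z /andP[z0 _] /rootP] := @poly_ivt _ (q - (q.[0] / 2)%:P) 0 1 ler01.
  by rewrite !hornerE; apply/andP; split; lra.
rewrite !hornerE => /eqP; rewrite subr_eq0 => /eqP qz.
have [e|zn0] := eqVneq z 0; first by rewrite e in qz; lra.
by have := pos z; rewrite lt_neqAle eq_sym zn0 z0 qz => /(_ isT); lra.
Qed.

Section Adjacent.
Variables (N m : nat).
Implicit Types (K : 'I_m -> 'I_N) (a b : 'I_N) (s : 'I_m).

Definition adjacent a b := (b == a.+1 :> nat) || (a == b.+1 :> nat).

Lemma increasing_upd K s b : increasing K -> adjacent (K s) b ->
  b \notin range K -> increasing (upd K s b).
Proof.
move=> inc adj bK u v uv.
have ne (w : 'I_m) : K w != b :> nat by apply: contraNneq bK => /val_inj <-; exact: mem_range.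
have := inc u v uv; have := ne u; have := ne v; move: adj; rewrite /adjacent /upd.
by case: (eqVneq u s) uv => [->|_]; case: (eqVneq v s) => [->|_]; rewrite ?ltnn //; lia.
Qed.

Lemma leq_increasing K (u : 'I_m) : increasing K -> (u <= K u)%N.
Proof.
move=> inc; case: u => n; elim: n => // n IH h.
by apply: leq_ltn_trans (IH (ltnW h)) _; apply: inc.
Qed.

(** Every increasing tuple descends by unit moves to the lowest one, [u] at place [u], and each move
    can be undone. *)
Lemma increasing_connected (P : ('I_m -> 'I_N) -> Prop) :
  (forall K s b, increasing K -> increasing (upd K s b) -> adjacent (K s) b ->
     P (upd K s b) -> P K) ->
  forall K L, increasing K -> increasing L -> P K -> P L.
Proof.
move=> step.
have bot K : increasing K -> exists2 B : 'I_m -> 'I_N, (forall u, B u = u :> nat) & (P K <-> P B).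
  have [n] := ubnP (\sum_u K u)%N; elim: n K => // n IH K /ltnSE-leK inc.
  have [s0 s0K|none] := pickP (fun s => K s != s :> nat); last first.
    by exists K => // u; apply/eqP; have := none u => /negbFE.
  (* The first entry above its lowest place can move down: the earlier entries all sit at their
     lowest places. *)
  have [s sK smin] := arg_minnP (P := fun s => K s != s :> nat) val s0K.
  have sKs : (s < K s)%N by rewrite ltn_neqAle eq_sym sK leq_increasing.
  have bN : ((K s).-1 < N)%N by apply: leq_ltn_trans (leq_pred _) (ltn_ord _).
  pose b := Ordinal bN.
  have adj : adjacent (K s) b by rewrite /adjacent /=; apply/orP; right; apply/eqP; lia.
  have adj' : adjacent b (K s) by rewrite /adjacent orbC.
  have incb : increasing (upd K s b).
    apply: increasing_upd => //; apply/rangeP => -[u /(congr1 val) /= eu].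
    have [us|us|/val_inj us] := ltngtP u s; last by rewrite us in eu; lia.
      have : K u == u :> nat by apply: contraTT us; rewrite -leqNgt; exact: smin.
      by lia.
    by have := inc _ _ us; lia.
  have [|//|B Bb PB] := IH (upd K s b).
    apply: leq_trans leK; rewrite [X in (_ < X)%N](bigD1 s) //= (bigD1 s) //= upd_eq.
    rewrite (eq_bigr (fun u => K u : nat)) ?ltn_add2r /=; last by move=> u us; rewrite upd_neq.
    by lia.
  exists B => //; rewrite -PB; split; last exact: step.
  by rewrite -{1}(upd_id K s) -(upd_upd K s b); apply: step; rewrite ?upd_upd ?upd_id ?upd_eq.
move=> K L /bot[B Bb ->] /bot[B' B'b ->].
by suff -> : B = B' by []; apply: funext => u; apply: val_inj; rewrite /= Bb B'b.
Qed.

End Adjacent.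

Section RowOperation.
Variables (R : realFieldType) (N m : nat).
Implicit Types (X : 'M[R]_(N, m)) (K : 'I_m -> 'I_N).

Definition totally_nonneg X := forall K, increasing K -> 0 <= minor X K.

(** Adding [t] times row [b] to row [a], written as a line in [t] to fit [poly_along_lines]. *)
Definition add_row X a b t : 'M[R]_(N, m) := X + t *: (delta_mx a b *m X).

Lemma add_rowE X a b t e j : add_row X a b t e j = X e j + t * ((e == a)%:R * X b j).
Proof.
rewrite !mxE (bigD1 b) //= !mxE eqxx andbT big1 ?addr0 // => c cb.
by rewrite !mxE (negPf cb) andbF mul0r.
Qed.

Lemma minor_add_row_notin X a b t K : a \notin range K ->
  minor (add_row X a b t) K = minor X K.
Proof.
move=> aK; congr (\det _); apply/matrixP => u j; rewrite mxE add_rowE mxE.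
by rewrite (negPf (notin_range u aK)) mul0r mulr0 addr0.
Qed.

Lemma minor_add_row X b t K s : injective K ->
  minor (add_row X (K s) b t) K = minor X K + t * minor X (upd K s b).
Proof.
move=> iK; have YE u j : rowsub K (add_row X (K s) b t) u j
    = X (K u) j + t * ((K u == K s)%:R * X b j) by rewrite mxE add_rowE.
rewrite -[minor X K]mul1r; apply: (determinant_multilinear (i0 := s)).
- by apply/rowP => j; rewrite [LHS]mxE YE ![in RHS]mxE eqxx mul1r mul1r upd_eq.
- apply/matrixP => u j; rewrite [RHS]mxE YE !mxE.
  by rewrite (inj_eq iK) eq_sym (negPf (neq_lift s u)) mul0r mulr0 addr0.
apply/matrixP => u j; rewrite [RHS]mxE YE !mxE.
rewrite (inj_eq iK) [lift _ _ == _]eq_sym (negPf (neq_lift s u)) mul0r mulr0 addr0.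
by rewrite upd_neq // eq_sym neq_lift.
Qed.

(** The correction is [t] times the minor with [a] replaced by [b]. Since [a] and [b] are adjacent,
    that tuple is still increasing or has a repeated row. *)
Lemma minor_add_row_ge X a b t K : totally_nonneg X -> increasing K -> adjacent a b ->
  0 < t -> minor X K <= minor (add_row X a b t) K.
Proof.
move=> tnn inc adj t0; case: (boolP (a \in range K)) => [/rangeP[s es]|h]; last first.
  by rewrite minor_add_row_notin.
rewrite es minor_add_row; last exact: increasing_inj.
rewrite lerDl (pmulr_rge0 _ t0).
case: (boolP (b \in range K)) => [/rangeP[u eu]|h]; last first.
  by apply: tnn; apply: increasing_upd => //; rewrite -es.
have su : s != u.
  by apply: contraTneq adj => su; rewrite es eu su /adjacent; lia.
by rewrite (minor_alt _ su) // upd_eq upd_neq // eq_sym.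
Qed.

End RowOperation.

Section Perturbation.
Variables (R : rcfType) (N m : nat).
Implicit Types (X E : 'M[R]_(N, m)) (K : 'I_m -> 'I_N) (Q : 'M[R]_(N, m) -> R).

Definition poly_along_lines Q :=
  forall X E, exists q : {poly R}, forall t, Q (X + t *: E) = q.[t].

Lemma poly_along_minor K : poly_along_lines (fun X => minor X K).
Proof.
move=> X E; exists (minor (map_mx polyC X + 'X *: map_mx polyC E) K) => t.
rewrite -[RHS]/(horner_eval t _) /minor -det_map_mx; congr (\det _).
by apply/matrixP => a b; rewrite !mxE /= /horner_eval hornerD hornerM !hornerC hornerX.
Qed.

Lemma poly_along_cst (c : R) : poly_along_lines (fun=> c).
Proof. by move=> X E; exists c%:P => t; rewrite hornerC. Qed.

Lemma poly_along_mul Q Q' : poly_along_lines Q -> poly_along_lines Q' ->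
  poly_along_lines (fun X => Q X * Q' X).
Proof.
move=> h h' X E; have [q qE] := h X E; have [q' qE'] := h' X E.
by exists (q * q') => t; rewrite hornerM qE qE'.
Qed.

Lemma poly_along_sub Q Q' : poly_along_lines Q -> poly_along_lines Q' ->
  poly_along_lines (fun X => Q X - Q' X).
Proof.
move=> h h' X E; have [q qE] := h X E; have [q' qE'] := h' X E.
by exists (q - q') => t; rewrite hornerD hornerN qE qE'.
Qed.

Lemma poly_along_sum (T : finType) (P : pred T) (F : T -> 'M[R]_(N, m) -> R) :
  (forall k, poly_along_lines (F k)) ->
  poly_along_lines (fun X => \sum_(k | P k) F k X).
Proof.
move=> h X E; have q k := cid (h k X E).
exists (\sum_(k | P k) projT1 (q k)) => t; rewrite horner_sum.
by apply: eq_bigr => k _; exact: (projT2 (q k)).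
Qed.

(* Adding a small multiple of a row to an adjacent one keeps all maximal minors
   nonnegative and makes one more of them positive. *)
Lemma totally_nonneg_perturb Q : poly_along_lines Q ->
  (forall X, totally_positive X -> 0 <= Q X) ->
  (forall X, (forall K, increasing K -> minor X K = 0) -> 0 <= Q X) ->
  forall X, totally_nonneg X -> 0 <= Q X.
Proof.
move=> Qpoly Qpos Q0 X.
(* The induction is on the number of vanishing increasing minors; finite functions make them a
   finite set. *)
pose Z (Y : 'M[R]_(N, m)) := [set K : {ffun 'I_m -> 'I_N} | `[< increasing K >] && (minor Y K == 0)].
have [n] := ubnP #|Z X|; elim: n X => // n IH X /ltnSE-leZ tnn.
have [allpos|] := pselect (forall K, increasing K -> minor X K != 0).
  by apply: Qpos => K inc; rewrite lt_neqAle eq_sym allpos //= tnn.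
move=> /existsNP[L /not_implyP[incL /negP/negPn/eqP L0]].
(* Look for a vanishing minor one unit move away from a nonvanishing one. If there is none,
   connectedness makes all increasing minors vanish, since one does. *)
have [[K [s [b [incK incb adj K0 b0]]]]|none] := pselect (exists K s b,
    [/\ increasing K, increasing (upd K s b), adjacent (K s) b, minor X K = 0
      & minor X (upd K s b) != 0]); last first.
  apply: Q0 => K inc; apply/eqP/negPn/negP => K0; move: L0; apply/eqP.
  apply: (@increasing_connected N m (fun K => minor X K != 0)) inc incL K0.
  move=> K' s b inc' incb adj h; apply/negP => /eqP h'; apply: none.
  by exists K', s, b.
have [q qE] := Qpoly X (delta_mx (K s) b *m X).
have -> : Q X = q.[0] by rewrite -qE scale0r addr0.
apply: poly_ge0_at0 => t t0; rewrite -qE -/(add_row X (K s) b t).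
have tnnY : totally_nonneg (add_row X (K s) b t).
  by move=> K' inc'; apply: le_trans (tnn _ inc') (minor_add_row_ge tnn inc' adj t0).
apply: IH => //; apply: leq_trans leZ; apply: proper_card; apply/properP; split.
  apply/subsetP => K'; rewrite !inE => /andP[/asboolP inc' /eqP h].
  rewrite asboolT //= eq_le tnn // andbT -h; exact: minor_add_row_ge.
have fE : finfun K =1 K :> ('I_m -> 'I_N) by move=> u; rewrite ffunE.
exists (finfun K); rewrite inE (funext fE) asboolT //= ?K0 ?eqxx //.
rewrite minor_add_row; last exact: increasing_inj.
by rewrite K0 add0r mulf_neq0 // gt_eqF.
Qed.

End Perturbation.

(** * Representative matrices of points of the Grassmannian *)

Section Representatives.
Variables (R : realType) (m n : nat).
Implicit Types (X : 'M[R]_(m + n, m)) (V : {vspace 'cV[R]_(m + n)}).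

Lemma represents_mulmx X Y V : represents X V -> represents Y V ->
  exists g : 'M[R]_m, X = Y *m g.
Proof.
move=> [_ XV] [_ YV]; pose T := [tuple col t Y | t < m].
have TE : <<T>>%VS = V by rewrite -YV.
exists (\matrix_(u, t) coord T u (col t X)); apply/matrixP => e t.
have : col t X \in <<T>>%VS.
  by rewrite TE -XV memv_span //; apply/imageP; exists t.
move=> /coord_span /(congr1 (fun M : 'cV_(m + n) => M e 0)).
rewrite mxE summxE => ->; rewrite mxE; apply: eq_bigr => u _.
by rewrite !mxE -tnth_nth tnth_mktuple mxE mulrC.
Qed.

Lemma sorted_mktuple N (K : 'I_m -> 'I_N) : increasing K ->
  sorted (fun a b : 'I_N => (a < b)%N) [tuple K u | u < m].
Proof.
move=> inc; case: m K inc => [|k] K inc; first by rewrite (tuple0 [tuple K u | u < 0]).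
apply/(sortedP (K ord0)) => u; rewrite size_tuple => hu.
have nE (t : 'I_k.+1) : nth (K ord0) [tuple K u | u < k.+1] t = K t.
  by rewrite -tnth_nth tnth_mktuple.
by rewrite (nE (Ordinal (ltnW hu))) (nE (Ordinal hu)); exact: inc.
Qed.

Lemma in_tnn_Gr_totally_nonneg V : in_tnn_Gr V ->
  exists2 X, represents X V & totally_nonneg X.
Proof.
move=> [_ [X XV pos]]; exists X => // K inc; have := pos _ (sorted_mktuple inc).
rewrite /plucker (_ : tnth _ = K) //.
by apply: funext => u; rewrite tnth_mktuple.
Qed.

(** Changing the representative multiplies [Q] by a square, so it is enough to treat a totally
    nonnegative one, and perturbation reduces this to positive minors. *)
Lemma ge0_over_tnn_Gr_of_positive (Q : 'M[R]_(m + n, m) -> R) :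
  poly_along_lines Q ->
  (forall X g, Q (X *m g) = \det g ^+ 2 * Q X) ->
  (forall X, (forall K, minor X K = 0) -> Q X = 0) ->
  (forall X, totally_positive X -> 0 <= Q X) ->
  ge0_over_tnn_Gr Q.
Proof.
move=> Qpoly Qg Q0 Qpos V /in_tnn_Gr_totally_nonneg[Y YV tnn] X XV.
have [g ->] := represents_mulmx XV YV.
rewrite Qg mulr_ge0 ?sqr_ge0 //; apply: (totally_nonneg_perturb Qpoly Qpos _ tnn).
move=> Z Z0; rewrite Q0 // => K.
have [iK|niK] := pselect (injective K).
  have [w inc] := exists_sorting iK; have := Z0 _ inc.
  by rewrite minor_comp_perm => /eqP; rewrite mulf_eq0 signr_eq0 => /eqP.
move: niK => /existsNP[u /existsNP[t /not_implyP[e /eqP ut]]].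
exact: (minor_alt _ ut).
Qed.

(** The minor on the first [m] rows is positive, which makes the columns independent. *)
Lemma totally_positive_in_tnn_Gr X : totally_positive X -> (m <= m + n)%N ->
  exists2 V, in_tnn_Gr V & represents X V.
Proof.
move=> tp le; pose V := <<[seq col t X | t : 'I_m]>>%VS; pose K := widen_ord le.
have incK : increasing K by [].
have rX : \rank X = m.
  apply/eqP; rewrite eqn_leq rank_leq_col /=.
  have : \rank (rowsub K X) = m.
    apply: mxrank_unit; rewrite unitmxE unitfE.
    by have := tp _ incK; rewrite /minor; case: ltgtP.
  by move=> {1}<-; apply: mxrankS; exact: rowsub_sub.
exists V; last by split.
split; last first.
  exists X => // L sL; apply: ltW; apply: tp => u t ut.
  rewrite !(tnth_nth (K u)).
  apply: (sorted_ltn_nth (leT := fun a b : 'I_(m + n) => (a < b)%N)) => //.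
  - by move=> a b c; exact: ltn_trans.
  - by rewrite inE size_tuple.
  - by rewrite inE size_tuple.
have freeT : free [seq col t X | t : 'I_m].
  rewrite (_ : [seq col t X | t : 'I_m] = [tuple col t X | t < m]) //.
  apply/freeP => k k0.
  pose v : 'cV[R]_m := \col_t k t.
  have Xv : X *m v = 0.
    apply/colP => e; move/(congr1 (fun M : 'cV_(m + n) => M e 0)): k0.
    rewrite summxE !mxE => {2}<-; apply: eq_bigr => t _.
    by rewrite -tnth_nth tnth_mktuple !mxE mulrC.
  have v0 : v = 0.
    have : rowsub K X *m v = 0.
      by apply/colP => e; move/colP: Xv => /(_ (K e)); rewrite !mxE => {2}<-;
        apply: eq_bigr => t _; rewrite !mxE.
    move/(congr1 (mulmx (invmx (rowsub K X)))); rewrite mulmx0 mulKmx //.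
    rewrite unitmxE unitfE.
    by have := tp _ incK; rewrite /minor; case: ltgtP.
  by move=> t; move/colP: v0 => /(_ t); rewrite !mxE.
by rewrite /in_Gr /V (eqP freeT) size_image card_ord.
Qed.

End Representatives.

(** * Labelings and separating chords *)

Section Labeling.
Variables (m N : nat).
Implicit Types (I J : m.-tuple 'I_N).

Lemma cw_lt_trans (a : 'I_N) : transitive (cw_lt a).
Proof. by move=> x y z; exact: ltn_trans. Qed.

Lemma labeling_mono I J eta (i j : eta.+1.-tuple 'I_N) : labeling I J i j ->
  let rho := cw_dist (tnth i ord0) in
  [/\ forall r s : 'I_eta.+1, (r < s)%N -> (rho (tnth i r) < rho (tnth i s))%N,
      forall k l : 'I_eta.+1, (k < l)%N -> (rho (tnth j k) < rho (tnth j l))%N,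
      forall r : 'I_eta.+1, (rho (tnth i r) < rho (tnth j ord_max))%N &
      forall k : 'I_eta.+1, (rho (tnth i ord0) < rho (tnth j k))%N].
Proof.
move=> [_ _]; case: (tupleP i) => a i'; rewrite (tnth_nth a) /=.
set it := [tuple of a :: i'].
have lastE : last a j = nth a j eta by rewrite -nth_last size_tuple.
move=> /andP[].
rewrite -[path _ _ (rcons _ _)]/(sorted (cw_lt a) (rcons it (last a j))).
rewrite -[path _ _ _]/(sorted (cw_lt a) (a :: j)) => si sj.
have hi := sorted_ltn_nth (@cw_lt_trans a) a si.
have hj := sorted_ltn_nth (@cw_lt_trans a) a sj.
have niE (r : 'I_eta.+1) : nth a (rcons it (last a j)) r = tnth it r.
  by rewrite nth_rcons size_tuple ltn_ord -tnth_nth.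
have njE (k : 'I_eta.+1) : nth a (a :: j) k.+1 = tnth j k by rewrite (tnth_nth a).
have nlE : nth a (rcons it (last a j)) eta.+1 = tnth j ord_max.
  by rewrite nth_rcons size_tuple ltnn eqxx lastE (tnth_nth a).
have szi : size (rcons it (last a j)) = eta.+2 by rewrite size_rcons size_tuple.
have szj : size (a :: j) = eta.+2 by rewrite /= size_tuple.
have ini n : (n < eta.+2)%N -> n \in [pred n | (n < size (rcons it (last a j)))%N].
  by rewrite inE szi.
have inj n : (n < eta.+2)%N -> n \in [pred n | (n < size (a :: j))%N] by rewrite inE szj.
split=> [r s rs|k l kl|r|k].
- rewrite -[(_ < _)%N]/(cw_lt a (tnth it r) (tnth it s)) -!niE.
  by apply: hi => //; apply: ini; rewrite ?ltnS // ltnW.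
- rewrite -[(_ < _)%N]/(cw_lt a (tnth j k) (tnth j l)) -!njE.
  by apply: hj => //; apply: inj; rewrite ltnS.
- rewrite -[(_ < _)%N]/(cw_lt a (tnth it r) (tnth j ord_max)) -niE -nlE.
  by apply: hi => //; apply: ini; rewrite ?ltnS // ltnW.
rewrite -[(_ < _)%N]/(cw_lt a (nth a (a :: j) 0) (tnth j k)) -njE.
by apply: hj => //; apply: inj; rewrite ltnS.
Qed.

Lemma cw_dist_shift (a p x : 'I_N) :
  cw_dist p x = (if cw_dist a p <= cw_dist a x then cw_dist a x - cw_dist a p
                 else cw_dist a x + N - cw_dist a p)%N.
Proof.
have aN := ltn_ord a; have pN := ltn_ord p; have xN := ltn_ord x.
rewrite !cw_distE; case: (leqP p x) => h1; case: (leqP a x) => h2;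
  case: (leqP a p) => h3; case: leqP => h4; lia.
Qed.

Lemma cw_dist_lt (a x : 'I_N) : (cw_dist a x < N)%N.
Proof. by rewrite /cw_dist ltn_mod; case: N a => [[]|]. Qed.

(** If some [j_k] precedes some [i_r], then [i_1, j_k, i_r, j_eta] alternate around the circle and
    no chord separates them. Otherwise the chord from just before [i_1] to just before [j_1]
    works. *)
Lemma weakly_separatedP I J eta (i j : eta.+1.-tuple 'I_N) : labeling I J i j ->
  let rho := cw_dist (tnth i ord0) in
  weakly_separated I J <-> forall r k, (rho (tnth i r) < rho (tnth j k))%N.
Proof.
move=> lab rho; have [monoi monoj i_last first_j] := labeling_mono lab.
have [iE jE _] := lab; rewrite -!range_tnth in iE jE.
have iD r : tnth i r \in range (tnth I) :\: range (tnth J) by rewrite -iE mem_range.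
have jD k : tnth j k \in range (tnth J) :\: range (tnth I) by rewrite -jE mem_range.
rewrite /weakly_separated -!range_tnth; split; last first.
  move=> sep; exists (tnth i ord0), (tnth j ord0); apply/orP; left.
  apply/andP; split; apply/subsetP => e.
    by rewrite -iE => /rangeP[r ->]; rewrite inE sep.
  rewrite -jE => /rangeP[k ->]; rewrite !inE -leqNgt.
  by rewrite -/rho (smono_le monoj).
move=> [p [q pq]] r k; rewrite ltnNge; apply/negP => le.
have {}le : (rho (tnth j k) < rho (tnth i r))%N.
  rewrite ltn_neqAle le andbT (inj_eq (@cw_dist_inj _ _)); apply/eqP => e.
  by have := iD r; have := jD k; rewrite e !inE => /andP[/negP h _] /andP[_].
have h1 := first_j k; have h2 := i_last r.
have := cw_dist_lt (tnth i ord0) (tnth j ord_max).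
have := cw_dist_lt (tnth i ord0) p; have := cw_dist_lt (tnth i ord0) q.
rewrite -/rho in h1 h2 * => b1 b2 b3.
have rho0 : rho (tnth i ord0) = 0%N by rewrite /rho cw_distE leqnn subnn.
case/orP: pq => /andP[/subsetP A /subsetP B].
  have := A _ (iD ord0); have := A _ (iD r); have := B _ (jD k); have := B _ (jD ord_max).
  rewrite !inE -!leqNgt !(@cw_dist_shift (tnth i ord0) p) -/rho rho0.
  by do 5! case: ifP; lia.
have := B _ (iD ord0); have := B _ (iD r); have := A _ (jD k); have := A _ (jD ord_max).
rewrite !inE -!leqNgt !(@cw_dist_shift (tnth i ord0) p) -/rho rho0.
by do 5! case: ifP; lia.
Qed.

End Labeling.

(** * Weakly separated sets satisfy the inequalities *)

Section Terms.
Variables (R : realFieldType) (N m : nat) (I J : m.-tuple 'I_N).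
Hypotheses (uI : uniq I) (uJ : uniq J).
Variables (eta : nat) (i j : eta.-tuple 'I_N) (rho : 'I_N -> nat).
Hypothesis monoj : forall k l : 'I_eta, (k < l)%N -> (rho (tnth j k) < rho (tnth j l))%N.
Hypothesis jE : range (tnth j) = range (tnth J) :\: range (tnth I).

Lemma sum_labels (X : 'M[R]_(N, m)) s (l : 'I_eta) :
  \sum_(k < eta | (k <= l)%N)
    plucker (replace_entry I (tnth I s) (tnth j k)) X
    * plucker (replace_entry J (tnth j k) (tnth I s)) X
  = \sum_(t | (tnth J t \notin range (tnth I)) && (rho (tnth J t) <= rho (tnth j l))%N)
      minor X (upd (tnth I) s (tnth J t)) * minor X (upd (tnth J) t (tnth I s)).
Proof.
pose F y := plucker (replace_entry I (tnth I s) y) X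
    * plucker (replace_entry J y (tnth I s)) X.
transitivity (\sum_(y in range (tnth J) | (y \notin range (tnth I))
    && (rho y <= rho (tnth j l))%N) F y).
  transitivity (\sum_(k | (rho (tnth j k) <= rho (tnth j l))%N) F (tnth j k)).
    by apply: eq_bigl => k; rewrite (smono_le monoj).
  rewrite (@sum_range _ _ _ _ (fun y => (rho y <= rho (tnth j l))%N) F (smono_inj monoj)).
  by rewrite jE; apply: eq_bigl => y; rewrite inE andbA [(_ \notin _) && _]andbC.
rewrite -(@sum_range _ _ _ _ (fun y => (y \notin range (tnth I))
    && (rho y <= rho (tnth j l))%N) F (tuple_uniqP J uJ)).
by apply: eq_bigr => t _; rewrite /F /plucker !tnth_replace.
Qed.

End Terms.

Section System.
Variables (R : realType) (m n : nat) (I J : m.-tuple 'I_(m + n)).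
Hypotheses (uI : uniq I) (uJ : uniq J).

(** The constant [c] is 0 for the first family of inequalities and 1 for the second. *)
Let Q (c : R) (eta : nat) (i j : eta.-tuple 'I_(m + n)) (l r : 'I_eta) (X : 'M[R]_(m + n, m)) : R :=
  tuple_sgn R (replace_entry I (tnth i r) (tnth j l))
  * tuple_sgn R (replace_entry J (tnth j l) (tnth i r))
  * (\sum_(k < eta | (k <= l)%N)
       plucker (replace_entry I (tnth i r) (tnth j k)) X
       * plucker (replace_entry J (tnth j k) (tnth i r)) X
     - c * (plucker I X * plucker J X)).

Lemma system_ge0_of_positive c eta (i j : eta.-tuple 'I_(m + n)) (l r : 'I_eta) :
  (forall X, totally_positive X -> 0 <= Q c i j l r X) ->
  ge0_over_tnn_Gr (Q c i j l r).
Proof.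
apply: ge0_over_tnn_Gr_of_positive.
- have pp (K L : m.-tuple 'I_(m + n)) :
      poly_along_lines (fun X : 'M[R]__ => plucker K X * plucker L X).
    by apply: poly_along_mul; exact: poly_along_minor.
  apply: poly_along_mul; first exact: poly_along_cst.
  apply: poly_along_sub; first by apply: poly_along_sum => k; exact: pp.
  by apply: poly_along_mul; [exact: poly_along_cst | exact: pp].
- move=> X g.
  have pg (K : m.-tuple 'I_(m + n)) : plucker K (X *m g) = plucker K X * \det g.
    exact: minor_mulmx.
  move: (\det g) pg => d pg; rewrite /Q !pg [RHS]mulrCA; congr (_ * _); rewrite mulrBr mulr_sumr; congr (_ - _).
    by apply: eq_bigr => k _; rewrite !pg; ring.
  by ring.
move=> X X0; have p0 (K : m.-tuple 'I_(m + n)) : plucker K X = 0 by exact: X0.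
by rewrite /Q big1 ?p0 ?mulr0 ?subr0 ?mulr0 // => k _; rewrite !p0 mulr0.
Qed.

Variables (eta : nat) (i j : eta.+1.-tuple 'I_(m + n)).
Hypothesis lab : labeling I J i j.
Let rho := cw_dist (tnth i ord0).

Let monoi := let: And4 h _ _ _ := labeling_mono lab in h.
Let monoj := let: And4 _ h _ _ := labeling_mono lab in h.

Let iE : range (tnth i) = range (tnth I) :\: range (tnth J).
Proof. by have [h _ _] := lab; rewrite !range_tnth. Qed.

Let jE : range (tnth j) = range (tnth J) :\: range (tnth I).
Proof. by have [_ h _] := lab; rewrite !range_tnth. Qed.

Let iI : injective (tnth I). Proof. exact: tuple_uniqP. Qed.
Let iJ : injective (tnth J). Proof. exact: tuple_uniqP. Qed.

Lemma label_position r l : exists s t,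
  [/\ tnth i r = tnth I s, tnth j l = tnth J t,
      tnth I s \notin range (tnth J) & tnth J t \notin range (tnth I)].
Proof.
have : tnth i r \in range (tnth i) by exact: mem_range.
rewrite iE inE => /andP[irJ /rangeP[s es]].
have : tnth j l \in range (tnth j) by exact: mem_range.
rewrite jE inE => /andP[jlI /rangeP[t et]].
by exists s, t; rewrite -es -et.
Qed.

(** By [tuple_sgn_plucker] the two tuple signs are the signs of the two minors in the term of index
    [l]. *)
Lemma partial_sum_sign X (l r : 'I_eta.+1) c : totally_positive X ->
  (0 <= Q c i j l r X) =
  (0 <= plucker (replace_entry I (tnth i r) (tnth j l)) X
    * plucker (replace_entry J (tnth j l) (tnth i r)) X
    * (\sum_(k < eta.+1 | (k <= l)%N)
       plucker (replace_entry I (tnth i r) (tnth j k)) X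
       * plucker (replace_entry J (tnth j k) (tnth i r)) X
     - c * (plucker I X * plucker J X))).
Proof.
move=> tp; rewrite /Q; have [s [t [-> -> sJ tI]]] := label_position r l.
have h1 : 0 < tuple_sgn R (replace_entry I (tnth I s) (tnth J t))
    * plucker (replace_entry I (tnth I s) (tnth J t)) X.
  by apply: tuple_sgn_plucker => //; rewrite tnth_replace //; exact: upd_inj_range.
have h2 : 0 < tuple_sgn R (replace_entry J (tnth J t) (tnth I s))
    * plucker (replace_entry J (tnth J t) (tnth I s)) X.
  by apply: tuple_sgn_plucker => //; rewrite tnth_replace //; exact: upd_inj_range.
have := mulr_gt0 h1 h2; rewrite mulrACA => h.
by apply/idP/idP => h'; apply: same_sign_ge0 h'; rewrite // mulrC.
Qed.

Lemma system_of_separated : (forall r k, (rho (tnth i r) < rho (tnth j k))%N) ->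
  forall l r : 'I_eta.+1,
    ((l.+1 < eta.+1 - r.+1 + 1)%N -> ge0_over_tnn_Gr (Q 0 i j l r)) /\
    ((eta.+1 - r.+1 + 1 <= l.+1)%N -> ge0_over_tnn_Gr (Q 1 i j l r)).
Proof.
move=> sep l r; have [s [t [es et sJ tI]]] := label_position r l.
have Ic : {in range (tnth I) :\: range (tnth J), forall e, rho e < rho (tnth j ord0)}%N.
  by move=> e; rewrite -iE => /rangeP[r' ->].
have Jc : {in range (tnth J) :\: range (tnth I), forall e, rho (tnth j ord0) <= rho e}%N.
  by move=> e; rewrite -jE => /rangeP[k ->]; rewrite (smono_le monoj).
have irho : injective rho by exact: cw_dist_inj.
split=> lr; apply: system_ge0_of_positive => X tp; rewrite partial_sum_sign //;
  rewrite es (sum_labels uI uJ monoj jE) et /plucker !tnth_replace //.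
  rewrite mul0r subr0.
  apply: (head_ge0 irho (cw_dist_oriented _ tp) iI iJ Ic Jc sJ tI).
  (* Indices start at 0: the initial segment has [l.+1] elements, and [eta.+1 - r.+1] elements of I
     \ J follow [i_r]. *)
  rewrite -iE -jE -es -et (card_mono_le monoj) (card_mono_gt monoi); lia.
(* The product of the minors of [I] and [J] is the complete exchange sum, so the difference is minus
   the tail after [l]. *)
rewrite mul1r -[minor X _ * minor X (tnth J)](exchange_sum X (fun t' => (rho (tnth J t') <= rho (tnth J t))%N) sJ).
rewrite opprD addrA subrr sub0r.
apply: (tail_le0 irho (cw_dist_oriented _ tp) iI iJ Ic Jc sJ tI).
by rewrite -iE -jE -es -et (card_mono_lt monoi) (card_mono_gt monoj); lia.
Qed.

End System.

(** * Sets that are not weakly separated *)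

Section Rank.
Local Open Scope nat_scope.
Variables (N : nat) (rho : 'I_N -> nat) (D : {set 'I_N}).
Hypothesis irho : injective rho.
Implicit Types (e x y : 'I_N).

Definition between x y : {set 'I_N} := [set e in D | rho x < rho e < rho y].

Definition rank e : nat := #|[set e' in D | rho e' < rho e]|.

(** Ranks turn parities of counts between two points into parities of positions. *)
Lemma rank_between x y : x \in D -> rho x < rho y ->
  rank y = rank x + #|between x y| + 1.
Proof.
move=> xD xy; rewrite /rank -(cardsID [set e | rho e < rho x] [set e in D | rho e < rho y]).
have -> : [set e in D | rho e < rho y] :&: [set e | rho e < rho x]
    = [set e in D | rho e < rho x].
  apply/setP => e; rewrite !inE -andbA; congr (_ && _).
  by apply/andP/idP => [[]//|h]; split=> //; exact: ltn_trans xy.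
have -> : [set e in D | rho e < rho y] :\: [set e | rho e < rho x] = x |: between x y.
  apply/setP => e; rewrite !inE -leqNgt leq_eqVlt (inj_eq irho) [x == e]eq_sym.
  by have [->|_] := eqVneq e x; rewrite ?xD ?xy // andbCA.
by rewrite cardsU1 inE ltnn andbF add1n addn1 addnS.
Qed.

Lemma rank_lt x y : x \in D -> rho x < rho y -> rank x < rank y.
Proof. by move=> xD /(rank_between xD) ->; rewrite addn1 ltnS leq_addr. Qed.

Lemma rank_inj : {in D &, injective rank}.
Proof.
move=> x y xD yD; case: (ltngtP (rho x) (rho y)) => [h|h|/irho] //.
  by have := rank_lt xD h => /[swap] ->; rewrite ltnn.
by have := rank_lt yD h => /[swap] ->; rewrite ltnn.
Qed.

Lemma exists_succ x z : z \in D -> rho x < rho z ->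
  exists y, [/\ y \in D, rho x < rho y, rho y <= rho z & between x y = set0].
Proof.
move=> zD xz; have Pz : (z \in D) && (rho x < rho z) by rewrite zD.
have [y /andP[yD xy] ymin] := arg_minnP (P := fun e => (e \in D) && (rho x < rho e)) rho Pz.
exists y; split=> //; first exact: ymin.
apply/setP => e; rewrite !inE; apply/negP => /andP[eD /andP[xe ey]].
by have := ymin e; rewrite eD xe leqNgt ey => /(_ isT).
Qed.

Lemma rank_succ x y : x \in D -> rho x < rho y -> between x y = set0 ->
  rank y = (rank x).+1.
Proof. by move=> xD xy b0; rewrite (rank_between xD xy) b0 cards0 addn0 addn1. Qed.

End Rank.

Section Interlacing.
Local Open Scope nat_scope.
Variables (N : nat) (rho : 'I_N -> nat) (irho : injective rho) (eta : nat).
Variables (i j : 'I_eta.+1 -> 'I_N).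
Hypothesis monoi : forall r s : 'I_eta.+1, r < s -> rho (i r) < rho (i s).
Hypothesis monoj : forall k l : 'I_eta.+1, k < l -> rho (j k) < rho (j l).
Hypothesis i_last : forall r, rho (i r) < rho (j ord_max).
Hypothesis disjoint_ij : forall r k, i r != j k.
Hypothesis first_j : forall k, rho (i ord0) < rho (j k).

Local Notation D := (range i :|: range j).

Let iD r : i r \in D. Proof. by rewrite inE mem_range. Qed.
Let jD k : j k \in D. Proof. by rewrite inE mem_range orbT. Qed.
Let le_i r s : (rho (i r) <= rho (i s)) = (r <= s). Proof. exact: (smono_le monoi). Qed.
Let le_j r s : (rho (j r) <= rho (j s)) = (r <= s). Proof. exact: (smono_le monoj). Qed.
Let lt_i r s : (rho (i r) < rho (i s)) = (r < s). Proof. exact: (smono_lt monoi). Qed.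
Let lt_j r s : (rho (j r) < rho (j s)) = (r < s). Proof. exact: (smono_lt monoj). Qed.

(* Either [l] comes before the last element [i ord_max] of the first family, at
   a position of the other parity; or all such positions have the same parity,
   [i r] is the last element before [j ord0], and [l] the first one after
   [i ord_max]. *)
Lemma exists_violation r0 k0 : rho (j k0) < rho (i r0) ->
  exists r q l : 'I_eta.+1,
    [/\ rho (i r) < rho (j q), between rho D (i r) (j q) = set0 &
        [/\ eta.+1 - r.+1 + 1 <= l.+1, l < q, rho (j l) < rho (i r) &
            ~~ odd #|between rho D (j l) (i r)|]
     \/ [/\ l.+1 < eta.+1 - r.+1 + 1, q <= l, rho (i r) < rho (j l) &
            odd #|between rho D (i r) (j l)|]].
Proof.
move=> inv.
have lei r : rho (i r) <= rho (i ord_max) by rewrite le_i -ltnS.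
(* The successor in [D] of the last element of the first family must belong to the second. *)
have [y [yD ey _ eb]] := exists_succ (jD ord_max) (i_last ord_max).
have [q yq] : exists q, y = j q.
  move: yD; rewrite inE => /orP[] /rangeP[q yq]; last by exists q.
  by move: ey; rewrite yq ltnNge lei.
rewrite {}yq in ey eb; clear y yD.
have rq := rank_succ irho (iD ord_max) ey eb.
have [[l ljm lodd]|none] := pselect (exists2 l, rho (j l) < rho (i ord_max) &
    odd (rank rho D (i ord_max) + rank rho D (j l))).
  exists ord_max, q, l; split=> //; left; split=> //=.
  - by rewrite subnn.
  - by rewrite -lt_j; exact: ltn_trans ey.
  by move: lodd; rewrite (rank_between irho (jD l) ljm) !oddD /=; do 2 case: odd.
have par l : rho (j l) < rho (i ord_max) ->
    odd (rank rho D (i ord_max)) = odd (rank rho D (j l)).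
  by move=> h; apply/eqP; apply/negPn/negP => h'; apply: none; exists l; rewrite // oddD -negb_eqb.
have j0 : rho (j ord0) < rho (i ord_max).
  by apply: leq_ltn_trans (leq_trans inv (lei r0)); rewrite le_j.
(* [i r] is the last element of the first family before [j ord0], hence its immediate predecessor in
   [D]. *)
have [r rj rmax] := arg_maxnP (P := fun r => rho (i r) < rho (j ord0)) val (first_j ord0).
have b0 : between rho D (i r) (j ord0) = set0.
  apply/setP => e; rewrite !inE; apply/negP => /andP[/orP[] /rangeP[u ->] /andP[h1 h2]].
    by have := rmax u h2; rewrite /= leqNgt -lt_i h1.
  by move: h2; rewrite lt_j.
exists r, ord0, q; split=> //; right.
have rjq : rho (i r) < rho (j q) by apply: leq_ltn_trans (lei r) ey.
split=> //; last first.
  (* [j q] follows [i ord_max] and [j ord0] follows [i r] in rank, while [i ord_max] and [j ord0]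
     have ranks of equal parity; so the count between [i r] and [j q] is odd. *)
  have := rank_between irho (iD r) rjq; have := rank_succ irho (iD r) rj b0.
  have := par _ j0; rewrite rq => p1 p2 p3.
  have : odd (rank rho D (i ord_max)).+1 = odd (rank rho D (i r) + #|between rho D (i r) (j q)| + 1).
    by rewrite p3.
  by rewrite addn1 /= p1 p2 oddD /=; do 2 case: odd.
have kq (k : 'I_eta.+1) : k < q -> rho (j k) < rho (i ord_max).
  rewrite -lt_j => kq; rewrite ltnNge; apply/negP => h.
  have : j k \in between rho D (i ord_max) (j q).
    rewrite !inE mem_range orbT kq andbT ltn_neqAle h andbT (inj_eq irho).
    exact: disjoint_ij.
  by rewrite eb inE.
(* For [k < q] the successor of [j k] has the other parity, so it is some [i s] other than
   [i ord_max]. This injects the indices below [q] into those strictly between [r] and [eta], whence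
   the bound on [q]. *)
have /choice[g gP] : forall k : 'I_eta.+1, exists s : 'I_eta.+1, k < q ->
    [/\ r < s, s < eta & rank rho D (i s) = (rank rho D (j k)).+1].
  move=> k; case: (boolP (k < q)) => [h|_]; last by exists r.
  have hk := kq _ h.
  have [y [yD ky ym yb]] := exists_succ (iD ord_max) hk.
  have ry := rank_succ irho (jD k) ky yb.
  move: yD; rewrite inE => /orP[] /rangeP[s ys]; rewrite {}ys in ky ym yb ry.
    exists s => _; split=> //.
      rewrite -lt_i; apply: ltn_trans rj _; apply: leq_ltn_trans ky; by rewrite le_j.
    rewrite ltn_neqAle -ltnS ltn_ord andbT; apply/eqP => es.
    have := par _ hk; rewrite (_ : ord_max = s) ?ry /=; first by case: odd.
    by apply: val_inj.
  have sm : rho (j s) < rho (i ord_max).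
    by rewrite ltn_neqAle ym andbT (inj_eq irho) eq_sym disjoint_ij.
  by have := par _ sm; rewrite (par _ hk) ry /=; case: odd.
have ginj : {in [set k : 'I_eta.+1 | k < q] &, injective g}.
  move=> k k'; rewrite !inE => /gP[_ _ h] /gP[_ _ h'] e.
  apply: (smono_inj monoj); apply: (@rank_inj _ rho D irho) => //.
  by apply: succn_inj; rewrite -h -h' e.
have re : r < eta by rewrite -[eta]/(val (@ord_max eta)) -lt_i; exact: ltn_trans j0.
have : #|g @: [set k : 'I_eta.+1 | k < q]|
    <= #|[set s : 'I_eta.+1 | s < eta] :\: [set s : 'I_eta.+1 | s < r.+1]|.
  apply: subset_leq_card; apply/subsetP => _ /imsetP[k + ->].
  by rewrite !inE => /gP[rg ge _]; rewrite -leqNgt rg ge.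
rewrite card_in_imset // card_ord_lt ?(ltnW (ltn_ord q)) //.
rewrite cardsD card_ord_lt // (_ : _ :&: _ = [set s : 'I_eta.+1 | s < r.+1]); last first.
  by apply/setP => s; rewrite !inE andb_idl // ltnS => sr; exact: leq_ltn_trans re.
by rewrite card_ord_lt //; lia.
Qed.

End Interlacing.

(** * Vandermonde matrices with two nearly colliding nodes *)

Section Products.
Variables (R : realFieldType) (T : finType).
Implicit Types (A : {set T}) (f : T -> R).

Lemma prod_sign A f (B : pred T) : {in A, forall e, 0 < (-1) ^+ B e * f e} ->
  0 < (-1) ^+ #|[set e in A | B e]| * \prod_(e in A) f e.
Proof.
move=> h; have : 0 < \prod_(e in A) ((-1) ^+ B e * f e) by apply: prodr_gt0.
rewrite big_split /=.
rewrite (_ : \prod_(e in A) (-1) ^+ B e = (-1) ^+ #|[set e in A | B e]|) //.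
rewrite prodrXr -sum1_card [in RHS]big_mkcond [in LHS]big_mkcond /=; congr (_ ^+ _).
by apply: eq_bigr => e _; rewrite inE; case: (e \in A) => //=; case: (B e).
Qed.

Lemma prod_norm_le A f M n : 1 <= M -> (#|A| <= n)%N ->
  {in A, forall e, `|f e| <= M} -> `|\prod_(e in A) f e| <= M ^+ n.
Proof.
move=> M1 An h; rewrite normr_prod; apply: (@le_trans _ _ (M ^+ #|A|)).
  rewrite -prodr_const; apply: ler_prod => e eA; rewrite normr_ge0; exact: h.
exact: ler_weXn2l.
Qed.

End Products.

Section RotatedVandermonde.
Variables (R : realFieldType) (N m : nat) (a : 'I_N) (x : 'I_N -> R).
Local Notation rho := (cw_dist a).
Hypothesis incx : forall e e', (rho e < rho e')%N -> x e < x e'.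

Definition rotated_vdm : 'M[R]_(N, m) :=
  \matrix_(e, b) (cut_sign R a e ^+ m.-1 * vdm m x e b).

Local Notation p := (minor rotated_vdm).

Lemma rotated_vdm_totally_positive : totally_positive rotated_vdm.
Proof.
move=> K inc; apply: rotated_vdm_gt0; first exact: cut_sign_sq.
move=> u t /inc ut; have xN := ltn_ord (K u); have yN := ltn_ord (K t).
have aN := ltn_ord a.
have h1 : (rho (K u) < rho (K t))%N -> 0 < x (K t) - x (K u).
  by move=> /incx; rewrite subr_gt0.
have h2 : (rho (K t) < rho (K u))%N -> 0 < - (x (K t) - x (K u)).
  by move=> /incx; rewrite opprB subr_gt0.
rewrite !cw_distE in h1 h2; rewrite /cut_sign; move: h1 h2.
case: (leqP a (K u)) => hu; case: (leqP a (K t)) => ht h1 h2;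
  rewrite ?(mulr1, mul1r, mulrNN, mulN1r).
- by apply: h1; lia.
- by exfalso; lia.
- by apply: h2; lia.
- by apply: h1; lia.
Qed.

Lemma node_inj : injective x.
Proof.
move=> e e' h; apply: (@cw_dist_inj _ a); apply/eqP; apply/negPn.
by rewrite neq_ltn; apply/negP => /orP[] /incx; rewrite h ltxx.
Qed.

(** The factor by which the Vandermonde product changes at [e] when node [z] becomes node [y]. The
    value 1 at [z] and [y] lets products run over whole sets of rows. *)
Definition node_ratio z y e : R :=
  if (e == z) || (e == y) then 1 else (x y - x e) / (x z - x e).

Lemma node_ratio_neq0 z y e : node_ratio z y e != 0.
Proof.
rewrite /node_ratio; case: ifP => [_|/norP[ez ey]]; first exact: oner_neq0.
by rewrite mulf_neq0 ?invr_eq0 // subr_eq0 (inj_eq node_inj) eq_sym.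
Qed.

Lemma vdm_upd_ratio (K : 'I_m -> 'I_N) s y : injective K -> y \notin range K ->
  minor (vdm m x) (upd K s y)
  = minor (vdm m x) K * \prod_(e in range K) node_ratio (K s) y e.
Proof.
move=> iK yK; have [|C CE] := @minor_vdm_upd R N m x K s.
  by move=> u t _ _ /= /node_inj/iK.
rewrite -[in X in _ = X * _](upd_id K s) !CE -mulrA; congr (_ * _).
rewrite big_imset /=; last by move=> ? ? _ _; exact: iK.
rewrite [X in _ = _ * X](bigD1 s) //= {1}/node_ratio eqxx mul1r -big_split /=.
apply: eq_bigr => u us; rewrite /node_ratio (inj_eq iK) (negPf us).
rewrite (negPf (notin_range u yK)) mulrC mulfVK // subr_eq0 (inj_eq node_inj).
by rewrite (inj_eq iK) eq_sym.
Qed.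

(** The replacement in [J] is inverse to that in [I], so ratios over common rows cancel. The cut
    signs cancel too, since the two tuples together keep the same rows. *)
Lemma exchange_ratio (I J : 'I_m -> 'I_N) s t : injective I -> injective J ->
  I s \notin range J -> J t \notin range I ->
  p (upd I s (J t)) * p (upd J t (I s)) = p I * p J *
   (\prod_(e in range I :\: range J) node_ratio (I s) (J t) e
    / \prod_(e in range J :\: range I) node_ratio (I s) (J t) e).
Proof.
move=> iI iJ sJ tI; set z := I s; set y := J t.
have W (w : 'I_N -> R) : (\prod_u w (upd I s y u)) * (\prod_u w (upd J t z u))
    = (\prod_u w (I u)) * (\prod_u w (J u)).
  rewrite (bigD1 s) // [X in _ * X](bigD1 t) // [in RHS](bigD1 s) //.
  rewrite [X in _ = _ * X](bigD1 t) //= !upd_eq mulrACA [RHS]mulrACA.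
  rewrite [w y * _]mulrC; congr (_ * (_ * _)); apply: eq_bigr => u us;
    by rewrite upd_neq.
have inv e : node_ratio y z e = (node_ratio z y e)^-1.
  by rewrite /node_ratio orbC; case: ifP; rewrite ?invr1 // invf_div.
rewrite !minor_scale_rows mulrACA (W (fun e => cut_sign R a e ^+ m.-1)) [in RHS](mulrACA (\prod_u cut_sign R a (I u) ^+ m.-1)) -!mulrA; congr (_ * (_ * _)).
have eI := vdm_upd_ratio s iI tI; have eJ := vdm_upd_ratio t iJ sJ.
rewrite -/z -/y in eI eJ; rewrite eI eJ.
under [\prod_(e in range J) _]eq_bigr do rewrite inv.
rewrite prodfV (big_setID (range J)) [X in _ / X](big_setID (range I)) /=.
rewrite [range J :&: _]setIC.
have P0 (A : {set 'I_N}) : \prod_(e in A) node_ratio z y e != 0.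
  by apply/prodf_neq0 => e _; exact: node_ratio_neq0.
have := P0 (range I :&: range J); have := P0 (range J :\: range I).
set A := \prod_(e in _ :&: _) _; set B := \prod_(e in range J :\: _) _.
by move=> B0 A0; field; rewrite A0 B0.
Qed.

End RotatedVandermonde.

Section Cluster.
Variables (R : realFieldType) (N : nat) (a z w : 'I_N) (eps : R).
Local Notation rho := (cw_dist a).
Hypotheses (zw : (rho z < rho w)%N) (eps0 : 0 < eps) (eps1 : eps <= 1).
Implicit Types e : 'I_N.

(* Squeezing the arc from [z] to [w] makes the node of [w] close to that of [z]. *)
Definition node e : R :=
  if (rho z < rho e <= rho w)%N
  then (rho z)%:R + eps * ((rho e)%:R - (rho z)%:R) else (rho e)%:R.

Lemma squeeze (u v : R) : u <= v -> 0 <= eps * (v - u) <= v - u.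
Proof. by rewrite -subr_ge0 => h; rewrite mulr_ge0 ?ler_piMl // ltW. Qed.

Lemma node_lt e e' : (rho e < rho e')%N -> node e < node e'.
Proof.
move=> ee'; rewrite /node.
have h : (rho e)%:R + 1 <= (rho e')%:R :> R by rewrite natr1 ler_nat.
case: ifP => [/andP[h1 h2]|h1]; case: ifP => [/andP[h3 h4]|h3].
- by rewrite ltrD2l ltr_pM2l // ltrD2r ltr_nat.
- have : (rho z)%:R <= (rho e)%:R :> R by rewrite ler_nat ltnW.
  by move=> /squeeze /andP[_]; lra.
- have : (rho e)%:R <= (rho z)%:R :> R by rewrite ler_nat; lia.
  have : 0 < eps * ((rho e')%:R - (rho z)%:R) by rewrite mulr_gt0 // subr_gt0 ltr_nat.
  by lra.
by lra.
Qed.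

Lemma node_bounds e : 0 <= node e <= (rho e)%:R.
Proof.
rewrite /node; case: ifP => [/andP[h1 h2]|_]; last by rewrite lexx ler0n.
have : (rho z)%:R <= (rho e)%:R :> R by rewrite ler_nat ltnW.
have : 0 <= (rho z)%:R :> R by rewrite ler0n.
by move=> p1 /squeeze/andP[p2 p3]; apply/andP; split; lra.
Qed.

Lemma node_dist_le e e' : `|node e - node e'| <= N%:R.
Proof.
have /andP[e0 e1] := node_bounds e; have /andP[e0' e1'] := node_bounds e'.
have : (rho e)%:R <= N%:R :> R by rewrite ler_nat ltnW ?cw_dist_lt.
have : (rho e')%:R <= N%:R :> R by rewrite ler_nat ltnW ?cw_dist_lt.
by rewrite ler_norml => h1 h2; lra.
Qed.

Lemma node_close : `|node z - node w| <= eps * N%:R.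
Proof.
rewrite /node ltnn leqnn zw /= opprD addrA subrr sub0r normrN.
have : (rho w)%:R <= N%:R :> R by rewrite ler_nat ltnW ?cw_dist_lt.
have : (rho z)%:R <= (rho w)%:R :> R by rewrite ler_nat ltnW.
have : 0 <= (rho z)%:R :> R by rewrite ler0n.
move=> h1 /squeeze/andP[h2 _] h3; rewrite ger0_norm // ler_pM2l //; lra.
Qed.

(** Outside the open arc from [z] to [w] only [w] leaves its integer position, and it stays above
    [z]; so only the pair of [z] and [w] can come close. *)
Lemma node_far e e' : (rho e <= rho z)%N || (rho w <= rho e)%N ->
  (rho e' <= rho z)%N || (rho w <= rho e')%N -> e != e' ->
  (e, e') != (z, w) -> (e', e) != (z, w) -> 1 <= `|node e - node e'|.
Proof.
wlog ee' : e e' / (rho e < rho e')%N => [wl|] he he' ne n1 n2.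
  have : rho e != rho e' by rewrite (inj_eq (@cw_dist_inj _ _)).
  rewrite neq_ltn => /orP[|] h; first exact: wl.
  by rewrite distrC; apply: wl => //; rewrite eq_sym.
have h : (rho e)%:R + 1 <= (rho e')%:R :> R by rewrite natr1 ler_nat.
rewrite ler0_norm ?subr_le0; last by apply/ltW/node_lt.
have [e'w|e'w] := eqVneq e' w.
  have ez : e != z by apply: contraNneq n1 => ->; rewrite e'w.
  have ez' : (rho e < rho z)%N.
    by rewrite ltn_neqAle (inj_eq (@cw_dist_inj _ _)) ez /=; move: ee'; rewrite e'w; lia.
  have hz : (rho e)%:R + 1 <= (rho z)%:R :> R by rewrite natr1 ler_nat.
  have hzw : (rho z)%:R <= (rho w)%:R :> R by rewrite ler_nat ltnW.
  have /andP[h1 _] := squeeze hzw.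
  by rewrite e'w /node zw leqnn [(rho z < rho e)%N]ltnNge (ltnW ez') /=; lra.
have /andP[_ e1] := node_bounds e.
suff -> : node e' = (rho e')%:R by lra.
have : rho e' != rho w by rewrite (inj_eq (@cw_dist_inj _ _)).
by rewrite /node; case: ifP => //; lia.
Qed.

End Cluster.

Section Ratios.
Variables (R : realFieldType) (N m : nat) (a : 'I_N) (I J : 'I_m -> 'I_N).
Hypotheses (iI : injective I) (iJ : injective J).
Variables (A B : {set 'I_N}) (z w : 'I_N).
Hypotheses (AE : A = range I :\: range J) (BE : B = range J :\: range I).
Hypotheses (zA : z \in A) (wB : w \in B).
Local Notation rho := (cw_dist a).
Hypotheses (zw : (rho z < rho w)%N) (btw : between rho (A :|: B) z w = set0).

Let in_between y e :=
  (rho z < rho e < rho y)%N || (rho y < rho e < rho z)%N.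

(** For [y] other than [w], the product defining [c y] contains the factor
    [(x z - x w) / (x y - x w)], which is small. Every other factor is bounded because its
    denominator is at least 1 in absolute value. *)
Lemma clustered_ratios (delta : R) : 0 < delta -> delta <= 1 ->
  exists (X : 'M[R]_(N, m)) (c : 'I_N -> R),
  [/\ totally_positive X,
      forall s t, I s = z -> J t \in B ->
        minor X (upd I s (J t)) * minor X (upd J t (I s))
        = minor X I * minor X J * c (J t),
      forall y, y \in B -> y != w -> `|c y| <= delta &
      forall y, y \in B -> 0 < (-1) ^+ #|[set e in A :|: B | in_between y e]| * c y].
Proof.
move=> d0 d1; pose M : R := N%:R.
have M1 : 1 <= M by rewrite ler1n (leq_ltn_trans _ (ltn_ord a)).
have M0 : 0 < M by exact: lt_le_trans M1.
(* The factor at [w] is at most [eps * M], and the others contribute at most [M ^+ N] over each of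
   [A] and [B]; this choice makes the total [delta]. *)
pose eps := delta / M ^+ (N + N).+1.
have MN1 : 1 <= M ^+ (N + N).+1 by exact: exprn_ege1.
have eps0 : 0 < eps by rewrite divr_gt0 // exprn_gt0.
have eps1 : eps <= 1.
  by rewrite ler_pdivrMr ?exprn_gt0 // mul1r (le_trans d1).
pose x := node a z w eps.
have incx e e' : (rho e < rho e')%N -> x e < x e' by exact: node_lt.
have AB e : e \in A -> e \in B -> False.
  by rewrite AE BE !inE => /andP[/negP h _] /andP[_ /h].
have neAB e e' : e \in A -> e' \in B -> e != e'.
  by move=> eA e'B; apply/eqP => ee'; apply: (@AB e); rewrite // ee'.
have cardN (C : {set 'I_N}) : (#|C| <= N)%N.
  by rewrite -[X in (_ <= X)%N](card_ord N) max_card.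
have side_zw e : e \in A :|: B -> (rho e <= rho z)%N || (rho w <= rho e)%N.
  move=> eD; have : e \notin between rho (A :|: B) z w by rewrite btw inE.
  by rewrite inE eD /= negb_and -!leqNgt.
have zD : z \in A :|: B by rewrite inE zA.
have wD : w \in A :|: B by rewrite inE wB orbT.
have far_z e : e \in A :|: B -> e != z -> e != w -> 1 <= `|x z - x e|.
  move=> eD ez ew; apply: (node_far zw eps0 eps1) => //; try exact: side_zw.
  - by rewrite eq_sym.
  - by rewrite xpair_eqE eqxx.
  - by rewrite xpair_eqE (negPf ez).
have far_B y e : y \in B -> e \in A :|: B -> e != y -> e != z -> 1 <= `|x y - x e|.
  move=> yB eD ey ez; have yz : y != z by rewrite eq_sym neAB.
  apply: (node_far zw eps0 eps1); try by apply: side_zw => //; rewrite inE yB orbT.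
  - by rewrite eq_sym.
  - by rewrite xpair_eqE (negPf yz).
  - by rewrite xpair_eqE (negPf ez).
have le1M (u v : R) : `|u| <= M -> 1 <= `|v| -> `|u / v| <= M.
  move=> uM v1; rewrite normf_div ler_pdivrMr; last by exact: lt_le_trans v1.
  by apply: le_trans uM _; rewrite ler_peMr // ltW.
exists (rotated_vdm m a x).
exists (fun y => \prod_(e in A) node_ratio x z y e / \prod_(e in B) node_ratio x z y e).
split.
- exact: rotated_vdm_totally_positive.
- move=> s t es tB; have sJ : I s \notin range J.
    by move: zA; rewrite AE -es inE => /andP[].
  have tI : J t \notin range I by move: tB; rewrite BE inE => /andP[].
  by rewrite (exchange_ratio incx iI iJ sJ tI) es AE BE.
- move=> y yB yw; rewrite -prodfV normrM.
  have yz : y != z by rewrite eq_sym neAB.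
  have hA : `|\prod_(e in A) node_ratio x z y e| <= M ^+ N.
    apply: prod_norm_le => // e eA; rewrite /node_ratio; case: ifP => [_|/norP[ez ey]].
      by rewrite normr1.
    apply: le1M; first by apply: node_dist_le.
    by apply: far_z => //; [rewrite inE eA | exact: neAB].
  have hB : `|\prod_(e in B) (node_ratio x z y e)^-1| <= eps * M * M ^+ N.
    rewrite (bigD1 w) //= normrM ler_pM ?normr_ge0 //.
      rewrite /node_ratio ifF ?invf_div; last first.
        by apply/negP => /orP[] /eqP h; [move: (neAB _ _ zA wB); rewrite h eqxx
          | rewrite h eqxx in yw].
      rewrite normf_div ler_pdivrMr; last first.
        by apply: lt_le_trans (far_B _ _ yB wD _ _); rewrite // 1?eq_sym // neAB.
      apply: le_trans (node_close zw eps0 eps1) _.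
      rewrite ler_peMr //; first by rewrite mulr_ge0 // ltW.
      by apply: far_B; rewrite // 1?eq_sym // neAB.
    rewrite (eq_bigl (fun e => e \in B :\ w)); last first.
      by move=> e; rewrite !inE andbC.
    apply: prod_norm_le => // e; rewrite !inE => /andP[ew eB].
    rewrite /node_ratio; case: ifP => [_|/norP[ez ey]]; first by rewrite invr1 normr1.
    rewrite invf_div; apply: le1M; first by apply: node_dist_le.
    by apply: far_B; rewrite ?inE ?eB ?orbT.
  apply: le_trans (ler_pM _ _ hA hB) _; rewrite ?normr_ge0 //.
  rewrite [X in X <= _](_ : _ = eps * M ^+ (N + N).+1); last by rewrite exprS exprD; ring.
  by rewrite /eps divfK // gt_eqF // exprn_gt0.
move=> y yB.
have zy : z != y by exact: neAB.
(* A ratio is negative exactly when [e] lies strictly between [z] and [y]. *)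
have sgn e : 0 < (-1) ^+ (in_between y e : nat) * node_ratio x z y e.
  rewrite /node_ratio /in_between.
  have [->|ez] /= := eqVneq e z; first by rewrite ltnn !andbF mulr1.
  have [->|ey] /= := eqVneq e y; first by rewrite ltnn !andbF mulr1.
  have : rho e != rho z by rewrite (inj_eq (@cw_dist_inj _ _)).
  have : rho e != rho y by rewrite (inj_eq (@cw_dist_inj _ _)).
  case: (ltngtP (rho e) (rho y)) => // he _; case: (ltngtP (rho e) (rho z)) => // he' _;
    rewrite ?andbF ?andbT /= ?mul1r ?mulN1r.
  - by rewrite divr_gt0 // subr_gt0 incx.
  - by rewrite -mulrN -invrN divr_gt0 ?opprB ?subr_gt0 ?incx.
  - by rewrite -mulNr divr_gt0 ?opprB ?subr_gt0 ?incx.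
  - by rewrite -mulrNN -invrN divr_gt0 ?opprB ?subr_gt0 ?incx.
have pA := prod_sign (A := A) (fun e _ => sgn e).
have pB := prod_sign (A := B) (fun e _ => sgn e).
have -> : #|[set e in A :|: B | in_between y e]|
    = (#|[set e in A | in_between y e]| + #|[set e in B | in_between y e]|)%N.
  rewrite -cardsUI [X in (_ + X)%N](_ : _ = 0%N) ?addn0.
    by apply: eq_card => e; rewrite !inE andb_orl.
  apply/eqP; rewrite cards_eq0; apply/eqP/setP => e; rewrite !inE.
  by apply/negP => /andP[/andP[eA _] /andP[eB _]]; exact: (AB e).
have : 0 < ((-1) ^+ #|[set e in A | in_between y e]| * \prod_(e in A) node_ratio x z y e)
   / ((-1) ^+ #|[set e in B | in_between y e]| * \prod_(e in B) node_ratio x z y e).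
  by rewrite divr_gt0.
by rewrite invr_signM mulrACA -exprD.
Qed.

End Ratios.

Lemma strictly_between_sym (x y e : nat) : (y < x)%N ->
  (x < e < y)%N || (y < e < x)%N = (y < e < x)%N.
Proof. lia. Qed.

(** * The failing inequality *)

Section Converse.
Variables (R : realType) (m n : nat) (I J : m.-tuple 'I_(m + n)).
Hypotheses (uI : uniq I) (uJ : uniq J).
Variables (eta : nat) (i j : eta.+1.-tuple 'I_(m + n)).
Hypothesis lab : labeling I J i j.
Let rho := cw_dist (tnth i ord0).

Lemma sum_lt1 (P : pred 'I_eta.+1) (c : 'I_eta.+1 -> R) :
  (forall k, P k -> `|c k| <= eta.+2%:R^-1) -> `|\sum_(k | P k) c k| < 1.
Proof.
move=> h; apply: le_lt_trans (ler_norm_sum _ _ _) _.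
apply: (@le_lt_trans _ _ (\sum_(k | P k) eta.+2%:R^-1)); first exact: ler_sum.
rewrite sumr_const; apply: (@le_lt_trans _ _ (eta.+2%:R^-1 *+ eta.+1)).
  by rewrite ler_wpMn2l // ?invr_ge0 ?ler0n // -[X in (_ <= X)%N]card_ord max_card.
by rewrite -(mulr_natl eta.+2%:R^-1) ltr_pdivrMr ?ltr0n // mul1r ltr_nat.
Qed.

(** Divided by the minors of [I] and [J], the terms add up to 1 and all but the one at [q] are
    small. If [l < q], the sum up to [l] is below 1 while its last term is positive. If [q <= l],
    the sum is positive while its last term is negative. *)
Lemma separated_of_system :
  (forall l r : 'I_eta.+1,
    ((l.+1 < eta.+1 - r.+1 + 1)%N -> ge0_over_tnn_Gr (fun X : 'M[R]_(m + n, m) =>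
       tuple_sgn R (replace_entry I (tnth i r) (tnth j l))
       * tuple_sgn R (replace_entry J (tnth j l) (tnth i r))
       * (\sum_(k < eta.+1 | (k <= l)%N)
            plucker (replace_entry I (tnth i r) (tnth j k)) X
            * plucker (replace_entry J (tnth j k) (tnth i r)) X
          - 0 * (plucker I X * plucker J X)))) /\
    ((eta.+1 - r.+1 + 1 <= l.+1)%N -> ge0_over_tnn_Gr (fun X : 'M[R]_(m + n, m) =>
       tuple_sgn R (replace_entry I (tnth i r) (tnth j l))
       * tuple_sgn R (replace_entry J (tnth j l) (tnth i r))
       * (\sum_(k < eta.+1 | (k <= l)%N)
            plucker (replace_entry I (tnth i r) (tnth j k)) X
            * plucker (replace_entry J (tnth j k) (tnth i r)) X
          - 1 * (plucker I X * plucker J X))))) ->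
  forall r k, (rho (tnth i r) < rho (tnth j k))%N.
Proof.
move=> sys r0 k0; rewrite ltnNge; apply/negP => inv.
have [monoi monoj i_last first_j] := labeling_mono lab.
rewrite -/rho in monoi monoj i_last first_j.
have [iE jE _] := lab; rewrite -!range_tnth in iE jE.
have irho : injective rho by exact: cw_dist_inj.
have iI := tuple_uniqP I uI; have iJ := tuple_uniqP J uJ.
have disj r k : tnth i r != tnth j k.
  apply/eqP => e; have : tnth i r \in range (tnth i) by exact: mem_range.
  have : tnth j k \in range (tnth j) by exact: mem_range.
  by rewrite iE jE e !inE => /andP[/negP h _] /andP[_].
have {}inv : (rho (tnth j k0) < rho (tnth i r0))%N.
  by rewrite ltn_neqAle inv (inj_eq irho) eq_sym disj.
have [r [q [l [rq btw viol]]]] := exists_violation irho monoi monoj i_last disj first_j inv.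
have d0 : 0 < eta.+2%:R^-1 :> R by rewrite invr_gt0 ltr0n.
have d1 : eta.+2%:R^-1 <= 1 :> R by rewrite invf_le1 ?ltr0n // ler1n.
have [X [c [tp cE csmall csgn]]] :=
  clustered_ratios iI iJ iE jE (mem_range _ r) (mem_range _ q) rq btw d0 d1.
have small k : k != q -> `|c (tnth j k)| <= eta.+2%:R^-1.
  by move=> kq; rewrite csmall ?mem_range // (inj_eq (smono_inj monoj)).
pose P := plucker I X * plucker J X.
have term k : plucker (replace_entry I (tnth i r) (tnth j k)) X
    * plucker (replace_entry J (tnth j k) (tnth i r)) X = P * c (tnth j k).
  have [s [t [es et sJ tI]]] := label_position lab r k.
  rewrite es et /plucker !tnth_replace // -/(minor _ _) cE // -et.
  exact: mem_range.
have [w0 [_ I0]] := minor_sign tp iI; have [w1 [_ J0]] := minor_sign tp iJ.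
have P0 : P != 0.
  rewrite mulf_neq0 //; first by apply: contraTneq I0 => h; rewrite [minor _ _]h mulr0 ltxx.
  by apply: contraTneq J0 => h; rewrite [minor _ _]h mulr0 ltxx.
have P2 : 0 < P ^+ 2 by rewrite exprn_even_gt0.
have sumE (Q : pred 'I_eta.+1) : \sum_(k < eta.+1 | Q k)
     plucker (replace_entry I (tnth i r) (tnth j k)) X
     * plucker (replace_entry J (tnth j k) (tnth i r)) X
   = P * \sum_(k | Q k) c (tnth j k).
  by rewrite mulr_sumr; apply: eq_bigr => k _; rewrite term.
have total : \sum_k c (tnth j k) = 1.
  have [s [t [es et sJ tI]]] := label_position lab r ord_max.
  apply: (mulfI P0); rewrite mulr1 -sumE.
  transitivity (minor X (tnth I) * minor X (tnth J)); last by [].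
  rewrite -(exchange_sum X (fun t' => (rho (tnth J t') <= rho (tnth j ord_max))%N) sJ).
  rewrite [X in _ = _ + X]big_pred0 ?addr0 => [|t'].
    rewrite -(sum_labels uI uJ monoj jE) es; apply: eq_bigl => k.
    by rewrite -ltnS ltn_ord.
  apply/negP => /andP[tI']; have : tnth J t' \in range (tnth j).
    by rewrite jE inE tI' mem_range.
  by move=> /rangeP[k ->]; rewrite (smono_le monoj) -ltnS ltn_ord.
have le_mn : (m <= m + n)%N by rewrite leq_addr.
have [V VG XV] := totally_positive_in_tnn_Gr tp le_mn.
have use b : 0 <= tuple_sgn R (replace_entry I (tnth i r) (tnth j l))
       * tuple_sgn R (replace_entry J (tnth j l) (tnth i r))
       * (\sum_(k < eta.+1 | (k <= l)%N)
            plucker (replace_entry I (tnth i r) (tnth j k)) X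
            * plucker (replace_entry J (tnth j k) (tnth i r)) X
          - b * (plucker I X * plucker J X)) ->
   0 <= c (tnth j l) * (\sum_(k < eta.+1 | (k <= l)%N) c (tnth j k) - b).
  rewrite (partial_sum_sign uI uJ lab) // term sumE -/P => h.
  rewrite -(@pmulr_rge0 _ (P ^+ 2)) // (_ : _ * _ = P * c (tnth j l) *
    (P * (\sum_(k < eta.+1 | (k <= l)%N) c (tnth j k)) - b * P)) //; ring.
have csl := csgn _ (mem_range _ l); have [sysA sysB] := sys l r.
case: viol => [[cond lq lr dev]|[cond ql rl dodd]].
  have E : [set e in range (tnth i) :|: range (tnth j) |
      (rho (tnth i r) < rho e < rho (tnth j l))%N
      || (rho (tnth j l) < rho e < rho (tnth i r))%N]
      = between rho (range (tnth i) :|: range (tnth j)) (tnth j l) (tnth i r).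
    by apply/setP => e; rewrite !inE; rewrite strictly_between_sym.
  move: csl; rewrite -/rho E -signr_odd (negPf dev) mul1r => cl.
  have := use 1 (sysB cond V VG X XV); rewrite pmulr_rge0 // subr_ge0.
  apply/negP; rewrite -ltNge; apply: le_lt_trans (ler_norm _) _.
  apply: sum_lt1 => k kl; apply: small.
  by apply: contraTneq lq => <-; rewrite -leqNgt.
have E : [set e in range (tnth i) :|: range (tnth j) |
    (rho (tnth i r) < rho e < rho (tnth j l))%N
    || (rho (tnth j l) < rho e < rho (tnth i r))%N]
    = between rho (range (tnth i) :|: range (tnth j)) (tnth i r) (tnth j l).
  by apply/setP => e; rewrite !inE; congr (_ && _); rewrite orbC strictly_between_sym.
move: csl; rewrite -/rho E -signr_odd dodd expr1 mulN1r oppr_gt0 => cl.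
have := use 0 (sysA cond V VG X XV); rewrite nmulr_rge0 // subr0.
have := total; rewrite (bigID (fun k : 'I_eta.+1 => (k <= l)%N)) /=.
have : \sum_(k < eta.+1 | ~~ (k <= l)%N) c (tnth j k) < 1.
  apply: le_lt_trans (ler_norm _) _; apply: sum_lt1 => k kl; apply: small.
  by apply: contraNneq kl => ->.
by move=> s2 e s1; have := ler_ltD s1 s2; rewrite e add0r ltxx.
Qed.

End Converse.

Theorem theoremA (R : realType) (m n : nat) (hm : (1 <= m)%N) (hmn : (m <= n)%N)
    (I J : m.-tuple 'I_(m + n)) (uI : uniq I) (uJ : uniq J)
    (eta : nat) (heta : eta = #|[set x in I] :\: [set x in J]|)
    (i j : eta.-tuple 'I_(m + n)) (hij : labeling I J i j) :
  let Ikr (k r : 'I_eta) := replace_entry I (tnth i r) (tnth j k) in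
  let Jkr (k r : 'I_eta) := replace_entry J (tnth j k) (tnth i r) in
  (forall l r : 'I_eta,
     ((l.+1 < eta - r.+1 + 1)%N ->
        ge0_over_tnn_Gr (fun X : 'M[R]_(m + n, m) =>
          tuple_sgn R (Ikr l r) * tuple_sgn R (Jkr l r) *
          (\sum_(k < eta | (k <= l)%N)
             plucker (Ikr k r) X * plucker (Jkr k r) X))) /\
     ((eta - r.+1 + 1 <= l.+1)%N ->
        ge0_over_tnn_Gr (fun X : 'M[R]_(m + n, m) =>
          tuple_sgn R (Ikr l r) * tuple_sgn R (Jkr l r) *
          (\sum_(k < eta | (k <= l)%N)
             plucker (Ikr k r) X * plucker (Jkr k r) X
           - plucker I X * plucker J X))))
  <-> weakly_separated I J.
Proof.
move=> Ikr Jkr; rewrite /Ikr /Jkr; clear Ikr Jkr heta hmn.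
case: eta i j hij => [|eta] i j lab.
  (* With both differences empty any chord will do; a point of the circle exists because [m] is
     positive. *)
  split=> [_|_ []//]; pose a : 'I_(m + n) := Ordinal (leq_trans hm (leq_addr n m)).
  have [iE jE _] := lab; exists a, a; rewrite -iE -jE; apply/orP; left.
  apply/andP; split; apply/subsetP => e; rewrite inE => ee.
    by rewrite (tuple0 i) in ee.
  by rewrite (tuple0 j) in ee.
rewrite (weakly_separatedP lab).
split=> [sys|sep].
  apply: (@separated_of_system R m n I J uI uJ eta i j lab) => l r.
  have [s1 s2] := sys l r; split=> [/s1|/s2] h V VG X XV; have := h V VG X XV.
    by rewrite mul0r subr0.
  by rewrite mul1r.
move=> l r; have [s1 s2] := system_of_separated R uI uJ lab sep l r.
split=> [/s1|/s2] h V VG X XV; have := h V VG X XV.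
  by rewrite mul0r subr0.
by rewrite mul1r.
Qed.
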